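(* Let $\gamma\in(0,1)$, and for each $n$ let $\mathbf{G}=\mathbf{G}^{[n]}$ be an $m\times n$ standard Gaussian matrix with $m=m_n\le n$ and $m/n\to\gamma$ as $n\to\infty$. Then with probability $1$, as $n\to\infty$, $$\|\mathbf{G}^\dagger\|_{\mathrm F}\to\sqrt{\frac{\gamma}{1-\gamma}}\qquad\text{and}\qquad \limsup_{n\to\infty}\sqrt{n}\,\|\mathbf{G}^\dagger\|\le\frac{1}{1-\sqrt\gamma}.$$
   Context: A standard Gaussian matrix has i.i.d. $\mathbb{N}(0,1)$ entries. $\mathbf{G}^\dagger$ is the Moore–Penrose pseudo-inverse, $\|\cdot\|$ the spectral norm and $\|\cdot\|_{\mathrm F}$ the Frobenius norm. The matrices $\mathbf{G}^{[n]}$ are all defined on one probability space. *)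

(* Defs.v *)
From mathcomp Require Export all_boot all_order all_algebra.
From mathcomp Require Export all_classical all_reals all_analysis.
#[export] Set Implicit Arguments.
#[export] Unset Strict Implicit.
#[export] Unset Printing Implicit Defensive.
Export Order.TTheory GRing.Theory Num.Theory.
Export numFieldNormedType.Exports.

Local Open Scope classical_set_scope.
Local Open Scope ring_scope.

Section matrix_notions.
Context {R : realType}.

Definition frobenius_norm m n (A : 'M[R]_(m, n)) : R :=
  Num.sqrt (\sum_i \sum_j A i j ^+ 2).

(* On column vectors the Frobenius norm is the Euclidean norm, so this is the
   operator norm of A between Euclidean spaces. *)
Definition spectral_norm m n (A : 'M[R]_(m, n)) : R :=
  sup [set frobenius_norm (A *m x) | x in [set x : 'cV[R]_n |
    frobenius_norm x <= 1]].

Definition penrose m n (A : 'M[R]_(m, n)) (X : 'M[R]_(n, m)) : Prop :=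
  [/\ A *m X *m A = A, X *m A *m X = X,
      (A *m X)^T = A *m X & (X *m A)^T = X *m A].

(* The default value 0 is never used, by penrose_exists. *)
Definition mpinv m n (A : 'M[R]_(m, n)) : 'M[R]_(n, m) :=
  xget 0 [set X | penrose A X].

Lemma mulmx_tr_eq0 m n (A : 'M[R]_(m, n)) : A *m A^T = 0 -> A = 0.
Proof.
move=> AA0; apply/matrixP => i j; rewrite mxE.
have /eqP : (A *m A^T) i i = 0 by rewrite AA0 mxE.
rewrite mxE psumr_eq0 => [/allP/(_ j)|k _]; last first.
  by rewrite mxE -expr2 sqr_ge0.
by rewrite mem_index_enum mxE -expr2 sqrf_eq0 => /(_ isT)/eqP.
Qed.

Lemma gram_unitmx m n (A : 'M[R]_(m, n)) : row_free A -> A *m A^T \in unitmx.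
Proof.
move=> fA; rewrite -row_free_unit -kermx_eq0; apply/eqP.
apply: (row_free_inj fA); rewrite mul0mx; apply: mulmx_tr_eq0.
by rewrite trmx_mul !mulmxA -[_ *m A *m _]mulmxA mulmx_ker mul0mx.
Qed.

Lemma penrose_exists m n (A : 'M[R]_(m, n)) : exists X, penrose A X.
Proof.
have uF := gram_unitmx (row_base_free A).
have fC : row_free (col_base A)^T.
  by rewrite /row_free mxrank_tr; exact: col_base_full.
have := gram_unitmx fC; rewrite trmxK; move: uF (mulmx_base A) => {fC}.
move: (\rank A) (col_base A) (row_base A) => r C F uF CF uC.
set f := invmx (F *m F^T); set c := invmx (C^T *m C).
have fT : f^T = f by rewrite /f trmx_inv trmx_mul trmxK.
have cT : c^T = c by rewrite /c trmx_inv trmx_mul trmxK.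
have FB : F *m (F^T *m f) = 1%:M by rewrite mulmxA mulmxV.
have DC : (c *m C^T) *m C = 1%:M by rewrite -mulmxA mulVmx.
have symB : (F^T *m f *m F)^T = F^T *m f *m F.
  by rewrite !trmx_mul trmxK fT -!mulmxA.
have symD : (C *m (c *m C^T))^T = C *m (c *m C^T).
  by rewrite !trmx_mul trmxK cT -!mulmxA.
move: (F^T *m f) (c *m C^T) FB DC symB symD => B D FB DC symB symD.
have AX : A *m (B *m D) = C *m D.
  by rewrite -CF mulmxA -(mulmxA C F B) FB mulmx1.
have XA : (B *m D) *m A = B *m F.
  by rewrite -CF mulmxA -(mulmxA B D C) DC mulmx1.
exists (B *m D); split; rewrite ?AX ?XA //.
- by rewrite -CF mulmxA -(mulmxA C D C) DC mulmx1.
- by rewrite mulmxA -(mulmxA B F B) FB mulmx1.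
Qed.

Lemma penrose_unique m n (A : 'M[R]_(m, n)) X Y :
  penrose A X -> penrose A Y -> X = Y.
Proof.
move=> [AXA XAX AXT XAT] [AYA YAY AYT YAT].
have AXY : A *m X = A *m Y.
  rewrite -AXT -{1}AYA -[A *m Y *m A *m X]mulmxA trmx_mul AYT AXT.
  by rewrite !mulmxA AXA.
have XAY : X *m A = Y *m A.
  rewrite -XAT -{1}AYA !mulmxA -[X *m A *m Y *m A]mulmxA trmx_mul YAT XAT.
  by rewrite -!mulmxA [A *m (X *m A)]mulmxA AXA.
by rewrite -XAX XAY -mulmxA AXY mulmxA YAY.
Qed.

Lemma mpinvP m n (A : 'M[R]_(m, n)) X : penrose A X <-> X = mpinv A.
Proof.
have pA : penrose A (mpinv A) by apply: (@xgetPex _ 0); exact: penrose_exists.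
by split=> [pX|->//]; exact: (penrose_unique pX pA).
Qed.

Lemma spectral_norm_has_sup m n (A : 'M[R]_(m, n)) :
  has_sup [set frobenius_norm (A *m x) | x in [set x : 'cV[R]_n |
    frobenius_norm x <= 1]].
Proof.
split.
  exists (frobenius_norm (A *m (0 : 'cV[R]_n))), 0 => //=.
  rewrite /frobenius_norm big1.
    by rewrite sqrtr0.
  by move=> i _; rewrite big1// => j _; rewrite mxE expr0n.
exists (Num.sqrt (\sum_(i < m) \sum_(k < 1) (\sum_j `|A i j|) ^+ 2)).
move=> _ [x /= x1 <-]; rewrite ler_wsqrtr//; apply: ler_sum => i _.
apply: ler_sum => k _; rewrite -[leLHS]real_normK ?num_real//.
rewrite lerXn2r ?nnegrE ?sumr_ge0// mxE.
apply: (le_trans (ler_norm_sum _ _ _)); apply: ler_sum => j _.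
rewrite normrM ler_piMr//; apply: le_trans x1.
rewrite -sqrtr_sqr ler_wsqrtr// (bigD1 j)//= (bigD1 k)//= -addrA lerDl.
by rewrite addr_ge0// !sumr_ge0// => *; rewrite ?sumr_ge0// => *; rewrite sqr_ge0.
Qed.

End matrix_notions.

Section random_matrices.
Context {d : measure_display} {T : measurableType d} {R : realType}
  {P : probability T R}.

Definition mutually_independent (I : finType) (X : I -> {RV P >-> R}) : Prop :=
  forall (J : {set I}) (B : I -> set R),
    (forall i, i \in J -> measurable (B i)) ->
    P (\bigcap_(i in [set` J]) (X i @^-1` B i)) =
    (\prod_(i in J) P (X i @^-1` B i))%E.

(* A measure is only meaningful on measurable sets: the library's formulas for
   [distribution] and [normal_prob] need not agree on other sets. *)
Definition standard_normal (X : {RV P >-> R}) : Prop :=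
  forall B : set R, measurable B -> distribution P X B = normal_prob 0 1 B.

Definition standard_gaussian m n (G : 'M[{RV P >-> R}]_(m, n)) : Prop :=
  (forall i j, standard_normal (G i j)) /\
  mutually_independent (fun ij : 'I_m * 'I_n => G ij.1 ij.2).

Definition realization m n (G : 'M[{RV P >-> R}]_(m, n)) (w : T) :
  'M[R]_(m, n) := \matrix_(i, j) G i j w.

End random_matrices.

(* Main.v *)
(* Write m = m n, and for a Gaussian m x n matrix G let g_i be its rows.

   Frobenius norm. The squared norm of the i-th column of the pseudo-inverse is
   1 / D_i, where D_i is the squared distance from g_i to the span of the other
   rows. Conditionally on these, a rotation of the columns turns D_i into a sum
   of n - m + 1 squared independent standard Gaussian variables, so all D_i are
   n (1 - gamma + o(1)) by Chernoff's bound, and the sum of the m inverses tends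
   to gamma / (1 - gamma).

   Spectral norm (Silverstein's argument). Rotate the columns so that the first
   row becomes (a, 0, .., 0), then the other rows so that the rest of the first
   column becomes (b, 0, .., 0), and repeat with the remaining Gaussian block.
   In this bidiagonal form a^2 and b^2 are chi-square variables with about n - k
   and m - k degrees of freedom at step k, and Gershgorin's bound for the
   tridiagonal matrix G G^T gives (sqrt n - sqrt m)^2 - o(n) for its smallest
   eigenvalue. Rather than building this form, one bounds by induction the
   probability that the quadratic form of G G^T is too small: each rotation is
   fixed once one conditions on the row or column it acts upon.

   All the failure probabilities are summable in n, so the Borel-Cantelli lemma
   applies without any assumption on the joint law of the matrices. *)
From HB Require Import structures.
Require Import Defs.
From mathcomp Require Import lebesgue_measure measurable_realfun.
From mathcomp Require Import ring lra zify.

Local Open Scope classical_set_scope.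
Local Open Scope ring_scope.

(** * Families of independent standard Gaussian variables *)

Section borel.
Context {R : realType} (I : finType).

(* Being Borel is tested against all measurable families; the identity family
   on the sigma-algebra generated by [boxes] is the universal one. *)
Definition borel_set (S : set (I -> R)) : Prop :=
  forall d (T : measurableType d) (X : I -> T -> R),
    (forall i, measurable_fun setT (X i)) -> measurable [set w | S (X ^~ w)].

Definition borel_fun (F : (I -> R) -> \bar R) : Prop :=
  forall d (T : measurableType d) (X : I -> T -> R),
    (forall i, measurable_fun setT (X i)) ->
    measurable_fun setT (fun w => F (X ^~ w)).

Definition boxes : set (set (I -> R)) :=
  [set [set x | forall i, B i (x i)] | B in
    [set B : I -> set R | forall i, measurable (B i)]].

Lemma boxesI : setI_closed boxes.
Proof.
move=> _ _ [B mB <-] [C mC <-]; exists (fun i => B i `&` C i) => [i|].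
  exact: measurableI.
rewrite predeqE => x; split=> [BC|[Bx Cx] i //].
by split=> i; have [] := BC i.
Qed.

Lemma boxesT : boxes setT.
Proof. by exists (fun=> setT) => //; rewrite predeqE => x. Qed.

Lemma box_measurable d (T : measurableType d) (X : I -> T -> R)
    (B : I -> set R) :
  (forall i, measurable_fun setT (X i)) -> (forall i, measurable (B i)) ->
  measurable [set w | forall i, B i (X i w)].
Proof.
move=> mX mB; rewrite (_ : mkset _ = \bigcap_(i in [set` I]) (X i @^-1` B i)).
  apply: fin_bigcap_measurable => // i _.
  by rewrite -[X in measurable X]setTI; exact: mX.
by rewrite predeqE => w; split=> [BX i _|BX i]; [exact: BX|apply: BX].
Qed.

Lemma coord_measurable (i : I) :
  measurable_fun setT (fun x : g_sigma_algebraType boxes => x i).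
Proof.
move=> _ B mB; rewrite setTI; apply: sub_sigma_algebra.
exists (fun j => if j == i then B else setT) => [j|].
  by case: ifP.
rewrite predeqE => x; split=> [/(_ i)|Bx j]; rewrite /= ?eqxx//.
by case: ifP => // /eqP ->.
Qed.

Lemma family_measurable d (T : measurableType d) (X : I -> T -> R) :
  (forall i, measurable_fun setT (X i)) ->
  measurable_fun setT (fun w => X ^~ w : g_sigma_algebraType boxes).
Proof.
move=> mX; refine (@measurability _ _ T (g_sigma_algebraType boxes) setT _ boxes _ _) => //.
move=> _ [_ [B mB <-] <-]; rewrite setTI; exact: box_measurable.
Qed.

Lemma borel_fun_measurable F : borel_fun F ->
  measurable_fun setT (F : g_sigma_algebraType boxes -> \bar R).
Proof. by move=> /(_ _ _ _ coord_measurable). Qed.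

End borel.

Section gauss_family.
Context {R : realType}.
Local Notation N01 := (@normal_prob R 0 1).

(** Boxes over the whole of [I] suffice: the product formula for a subfamily is the case where [B i]
    is [setT] for the other indices. *)
Definition gauss_family d (T : measurableType d) (P : probability T R)
    (I : finType) (X : I -> T -> R) : Prop :=
  (forall i, measurable_fun setT (X i)) /\
  forall B : I -> set R, (forall i, measurable (B i)) ->
    P [set w | forall i, B i (X i w)] = (\prod_i N01 (B i))%E.

(** The image measures of [X] and [Y] agree on boxes, which are stable under intersection, hence on
    the sigma-algebra they generate. This moves a computation from [P1] to any space carrying a
    Gaussian family over the same index type. *)
Lemma gauss_family_same_law d1 d2 (T1 : measurableType d1)
    (T2 : measurableType d2) (P1 : probability T1 R) (P2 : probability T2 R)
    (I : finType) (X : I -> T1 -> R) (Y : I -> T2 -> R) (F : (I -> R) -> \bar R) :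
  gauss_family P1 X -> gauss_family P2 Y -> borel_fun F ->
  (forall x, 0 <= F x)%E ->
  (\int[P1]_w F (X ^~ w) = \int[P2]_w F (Y ^~ w))%E.
Proof.
move=> [mX lX] [mY lY] /borel_fun_measurable mF F0.
have mX' := family_measurable mX; have mY' := family_measurable mY.
have /= := @ge0_integral_pushforward _ _ _ _ R _ mX' P1 setT F measurableT mF
  (fun y _ => F0 y).
rewrite preimage_setT => <-.
have /= := @ge0_integral_pushforward _ _ _ _ R _ mY' P2 setT F measurableT mF
  (fun y _ => F0 y).
rewrite preimage_setT => <-.
pose mx := isMeasurableFun.Build _ _ _ _ _ mX'.
pose X' : {mfun _ >-> _} := HB.pack (fun w => X ^~ w : g_sigma_algebraType (@boxes R I)) mx.
pose my := isMeasurableFun.Build _ _ _ _ _ mY'.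
pose Y' : {mfun _ >-> _} := HB.pack (fun w => Y ^~ w : g_sigma_algebraType (@boxes R I)) my.
apply: (@eq_measure_integral _ _ _ _ (distribution P2 Y') (distribution P1 X')) => /= A mA _.
apply: (@measure_unique _ _ (g_sigma_algebraType (@boxes R I)) (@boxes R I) (fun=> setT)) => //.
- exact: boxesI.
- by move=> _; exact: boxesT.
- by rewrite bigcup_const//; exists 0%N.
- by move=> _ [B mB <-]; rewrite /= /distribution /pushforward /= [LHS]lX// [RHS]lY.
- by move=> _; rewrite /= /distribution /pushforward /= preimage_setT probability_setT ltry.
Qed.

Section one_space.
Context d (T : measurableType d) (P : probability T R).

Lemma gauss_family_comp (I J : finType) (X : I -> T -> R) (h : J -> I) :
  injective h -> gauss_family P X -> gauss_family P (X \o h).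
Proof.
move=> hI [mX lX]; split => [j|B mB]; first exact: mX.
(* The box is extended by [setT] outside the image of [h], where the factors of the product are
   1. *)
pose B' i := if [pick j | h j == i] is Some j then B j else setT.
have B'h j : B' (h j) = B j.
  rewrite /B'; case: pickP => [k /eqP/hI -> //|/(_ j)].
  by rewrite eqxx.
have B'N i : i \notin codom h -> B' i = setT.
  move=> /negP iN; rewrite /B'; case: pickP => // k /eqP ki.
  by case: iN; rewrite -ki codom_f.
have := lX B'; rewrite (_ : mkset _ = [set w | forall j, B j (X (h j) w)]).
  move=> ->; last by move=> i; rewrite /B'; case: pickP.
  rewrite (bigID (fun i => i \in codom h))/= [X in (_ * X)%E]big1 ?mule1.
    rewrite (reindex_omap h (fun i => [pick j | h j == i])).
      apply: eq_big => [j|j _]; last by rewrite B'h.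
      rewrite codom_f/=; case: pickP => [k /eqP/hI ->|/(_ j)]; rewrite eqxx//.
    move=> i /codomP[j ->]; case: pickP => [k /eqP/= ->//|/(_ j)].
    by rewrite eqxx.
  by move=> i iN; rewrite B'N// probability_setT.
rewrite predeqE => w; split=> /= [Bw j|Bw i].
  by rewrite -B'h; exact: Bw.
have [/codomP[j ->]|iN] := boolP (i \in codom h); first by rewrite B'h.
by rewrite B'N.
Qed.

(* The coordinates outside [J] are replaced by an independent copy, living on
   the second factor of [T * T]. This is how one conditions on those in [J]
   without any conditional expectation. *)
Definition mix (I : finType) (J : pred I) (X : I -> T -> R) (i : I) (w : T * T) :=
  if J i then X i w.1 else X i w.2.

Lemma gauss_family_mix (I : finType) (J : pred I) (X : I -> T -> R) :
  gauss_family P X -> gauss_family (P \x P)%E (mix J X).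
Proof.
move=> [mX lX]; split => [i|B mB].
  rewrite /mix; case: (J i); exact: measurableT_comp.
pose BJ i := if J i then B i else setT.
pose BK i := if J i then setT else B i.
have -> : [set w | forall i, B i (mix J X i w)] =
   [set w | forall i, BJ i (X i w)] `*` [set w | forall i, BK i (X i w)].
  rewrite predeqE => w; split=> [Bw|[Jw Kw] i].
    by split=> i; rewrite /BJ /BK; have := Bw i; rewrite /mix; case: (J i).
  by have := Jw i; have := Kw i; rewrite /mix /BJ /BK; case: (J i).
have mBJ i : measurable (BJ i) by rewrite /BJ; case: ifP.
have mBK i : measurable (BK i) by rewrite /BK; case: ifP.
transitivity (P [set w | forall i, BJ i (X i w)] *
              P [set w | forall i, BK i (X i w)])%E.
  by apply: product_measure1E; exact: box_measurable.
rewrite (lX _ mBJ) (lX _ mBK).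
rewrite -big_split/=; apply: eq_bigr => i _; rewrite /BJ /BK.
by case: (J i); rewrite probability_setT ?mule1 ?mul1e.
Qed.

(** The mixed family on [T * T] is Gaussian too, so it has the law of [X]; Tonelli's theorem then
    integrates the two copies one after the other. *)
Lemma gauss_family_split (I : finType) (J : pred I) (X : I -> T -> R)
    (F : (I -> R) -> \bar R) :
  gauss_family P X -> borel_fun F -> (forall x, 0 <= F x)%E ->
  (\int[P]_w F (X ^~ w) =
   \int[P]_w \int[P]_w' F (fun i => if J i then X i w else X i w'))%E.
Proof.
move=> gX mF F0.
have gY := gauss_family_mix J gX.
rewrite (gauss_family_same_law gX gY mF F0) fubini_tonelli1//.
by apply: mF; case: gY.
Qed.

(** The conditioning principle behind all tail bounds: a bound that holds for every frozen value of
    the coordinates in [J] holds without freezing them. Inside the hypothesis, [w] is fixed, so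
    rotations may depend on it. *)
Lemma gauss_family_split_le (I : finType) (J : pred I) (X : I -> T -> R)
    (S : set (I -> R)) (c : R) :
  gauss_family P X -> borel_set S -> 0 <= c ->
  (forall w, P [set w' | S (fun i => if J i then X i w else X i w')] <= c%:E)%E ->
  (P [set w | S (X ^~ w)] <= c%:E)%E.
Proof.
move=> gX mS c0 Sc; have mX := gX.1.
have bF : borel_fun (fun x => (\1_S x)%:E).
  move=> d' T' Y mY; apply/measurable_EFinP.
  rewrite (_ : (fun _ => _) = \1_[set w | S (Y ^~ w)]).
    by apply: measurable_indic; exact: mS.
  by apply/funext => w; rewrite !indicE; congr (_ %:R); rewrite mem_setE.
have intE (Y : I -> T -> R) : (forall i, measurable_fun setT (Y i)) ->
    (\int[P]_w (\1_S (Y ^~ w))%:E = P [set w | S (Y ^~ w)])%E.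
  move=> mY; rewrite -[in RHS](setIT (mkset _)) -integral_indic//; exact: mS.
rewrite -intE// (gauss_family_split J gX bF); last first.
  by move=> x; rewrite lee_fin.
rewrite -[leRHS]mule1 -(probability_setT P) -integral_cst//.
have mI i w : measurable_fun setT (fun w' => if J i then X i w else X i w').
  by case: (J i).
apply: ge0_le_integral => //.
- by move=> w _; apply: integral_ge0 => w' _; rewrite lee_fin.
- have gY := gauss_family_mix J gX.
  apply: (@measurable_fun_fubini_tonelli_F _ _ _ _ _ P
    (fun ww => (\1_S ((mix J X) ^~ ww))%:E)) => //.
  by apply: bF; case: gY.
- by move=> w _; rewrite (intE (fun i w' => if J i then X i w else X i w')).
Qed.

End one_space.
End gauss_family.

(** * Rotation invariance *)

Section affine_change_of_variable.
Context {R : realType}.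
Local Notation mu := (@lebesgue_measure R).
Variables (a b : R) (a0 : a != 0).

Let phi : measurableTypeR R -> measurableTypeR R := fun x => a * x + b.

Let mphi : measurable_fun setT phi.
Proof.
have : measurable_fun setT (fun x : R => a * x + b).
  by apply: measurable_funD => //; exact: measurable_funM.
exact.
Qed.

Let mu' : {measure set (measurableTypeR R) -> \bar R} :=
  mscale (NngNum (normr_ge0 a))
    (measure_function_pushforward__canonical__measure_function_Measure mu mphi).

(** The scaled image measure [mu'] gives half-open intervals their length, and this characterizes
    Lebesgue measure. For negative [a] the preimage of an interval is closed on the other side, with
    the same length. *)
Lemma lebesgue_measure_affine (A : set R) : measurable A ->
  mu A = (`|a|%:E * mu (phi @^-1` A))%E.
Proof.
move=> mA; rewrite (@lebesgue_measure_unique _ mu')// => _ [[u v] /= uv <-].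
rewrite /mu' /mscale/= /pushforward/=.
have [a_gt0|a_lt0|a00] := ltgtP 0 a; last by have := a0; rewrite -a00 eqxx.
- rewrite (_ : _ @^-1` _ = `](u - b) / a, (v - b) / a]%classic).
    rewrite !lebesgue_measure_itv/= !lte_fin ltr_pM2r ?invr_gt0// ltrD2r.
    case: ifPn => _; last by rewrite mule0.
    by rewrite gtr0_norm// -!EFinB -EFinM; congr EFin; field.
  apply/seteqP; split=> x /=; rewrite !in_itv/= /phi ltr_pdivrMr// ler_pdivlMr//;
  by rewrite ltrBlDr lerBrDr mulrC.
- rewrite (_ : _ @^-1` _ = `[(v - b) / a, (u - b) / a[%classic).
    rewrite !lebesgue_measure_itv/= !lte_fin ltr_nM2r ?invr_lt0// ltrD2r.
    case: ifPn => _; last by rewrite mule0.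
    by rewrite ltr0_norm// -!EFinB -EFinM; congr EFin; field.
  apply/seteqP; split=> x /=; rewrite !in_itv/= /phi ler_ndivrMr// ltr_ndivlMr//;
  by rewrite lerBrDr ltrBlDr mulrC andbC.
Qed.

Lemma ge0_integral_affine (f : R -> \bar R) :
  measurable_fun setT f -> (forall x, 0 <= f x)%E ->
  (\int[mu]_x f x = `|a|%:E * \int[mu]_x f (a * x + b)%R)%E.
Proof.
move=> mf f0.
rewrite (eq_measure_integral mu') => [|A mA _]; last first.
  exact: (lebesgue_measure_affine mA).
rewrite ge0_integral_mscale//=; congr (_ * _)%E.
by rewrite (ge0_integral_pushforward mphi)// preimage_setT.
Qed.

End affine_change_of_variable.

Section normal_density.
Context {R : realType}.
Local Notation mu := (@lebesgue_measure R).
Local Notation N01 := (@normal_prob R 0 1).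
Local Notation phi := (@normal_pdf R 0 1).

(** The Radon-Nikodym derivative of [N01] and the explicit density have the same integral over every
    measurable set, hence agree almost everywhere. *)
Lemma integral_N01 (f : R -> \bar R) :
  measurable_fun setT f -> (forall x, 0 <= f x)%E ->
  (\int[N01]_x f x = \int[mu]_x (f x * (phi x)%:E))%E.
Proof.
move=> mf f0.
have dom : N01 `<< mu by exact: normal_prob_dominates.
have gi := Radon_Nikodym_SigmaFinite.f_integrable dom.
have gE := Radon_Nikodym_SigmaFinite.f_integral dom.
rewrite -(Radon_Nikodym_SigmaFinite.change_of_variables dom)//.
apply: ae_eq_integral => //.
- by apply: emeasurable_funM => //; exact: measurable_int gi.
- apply: emeasurable_funM => //; apply/measurable_EFinP.
  exact: measurable_normal_pdf.
- apply: ae_eqe_mul2l; apply: integral_ae_eq => //.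
  + by apply/measurable_EFinP; exact: measurable_normal_pdf.
  + by move=> E _ mE; rewrite -gE.
Qed.

End normal_density.

Section plane_rotation.
Context {R : realType}.
Local Notation mu := (@lebesgue_measure R).
Local Notation N01 := (@normal_prob R 0 1).
Local Notation phi := (@normal_pdf R 0 1).
Variables (c s : R) (cs1 : c ^+ 2 + s ^+ 2 = 1).

Lemma measurable_comp2 d (T : measurableType d) (h : R -> R -> \bar R)
    (p q : T -> R) :
  measurable_fun setT (fun z : R * R => h z.1 z.2) ->
  measurable_fun setT p -> measurable_fun setT q ->
  measurable_fun setT (fun z => h (p z) (q z)).
Proof.
move=> mh mp mq.
apply: (measurableT_comp mh (f := fun z => h z.1 z.2) (g := fun z => (p z, q z))).
exact: measurable_fun_pair.
Qed.

Lemma swap_integral (h : R -> R -> \bar R) :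
  measurable_fun setT (fun z : R * R => h z.1 z.2) ->
  (forall x y, 0 <= h x y)%E ->
  (\int[mu]_x \int[mu]_y h x y = \int[mu]_y \int[mu]_x h x y)%E.
Proof.
move=> mh h0.
exact: (@fubini_tonelli _ _ _ _ R mu mu (fun z => h z.1 z.2) mh (fun z => h0 _ _)).
Qed.

(** The rotation is split into two one-dimensional affine substitutions: [c x - s y] replaces [x]
    for fixed [y], and then [y / c + s x / c] replaces [y] for fixed [x]. Their Jacobians [|c|] and
    [1 / |c|] cancel. *)
Lemma lebesgue_rotation (h : R -> R -> \bar R) :
  measurable_fun setT (fun z : R * R => h z.1 z.2) ->
  (forall x y, 0 <= h x y)%E ->
  (\int[mu]_x \int[mu]_y h (c * x - s * y)%R (s * x + c * y)%R =
   \int[mu]_x \int[mu]_y h x y)%E.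
Proof.
move=> mh h0.
have maff d (T : measurableType d) (a b : R) (p q : T -> R) :
    measurable_fun setT p -> measurable_fun setT q ->
    measurable_fun setT (fun z => a * p z + b * q z).
  by move=> mp mq; apply: measurable_funD; exact: measurable_funM.
have mfst : measurable_fun [set: R * R] fst by [].
have msnd : measurable_fun [set: R * R] snd by [].
have mid : measurable_fun [set: R] id by [].
(* For [c = 0] the substitutions would divide by zero, but then the rotation only exchanges the
   coordinates up to signs. *)
have [c0|c0] := eqVneq c 0.
  have s2 : s ^+ 2 = 1 by rewrite -cs1 c0 expr0n add0r.
  have s1 : `|s| = 1 by apply/eqP; rewrite -sqrp_eq1// real_normK ?num_real// s2.
  have s0 : s != 0 by rewrite -normr_gt0 s1.
  transitivity (\int[mu]_x \int[mu]_y h y (s * x)%R)%E.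
    apply: eq_integral => x _.
    rewrite (@ge0_integral_affine _ (- s) 0 _ (fun y => h y (s * x))) ?oppr_eq0//.
      rewrite normrN s1 mul1e; apply: eq_integral => y _.
      by rewrite c0 !mul0r addr0 add0r mulNr addr0.
    by apply: measurable_comp2 => //; exact: measurable_cst.
  rewrite (@swap_integral (fun x y => h y (s * x))) => [|//|//]; last first.
    by apply: measurable_comp2 => //; exact: measurable_funM.
  apply: eq_integral => y _.
  rewrite [RHS](@ge0_integral_affine _ s 0 _ (h y))//; last first.
    by apply: measurable_comp2 => //; exact: measurable_cst.
  by rewrite s1 mul1e; apply: eq_integral => x _; rewrite addr0.
have mh1 : measurable_fun setT
    (fun z : R * R => h z.1 (z.2 / c + s * z.1 / c)).
  apply: measurable_comp2 => //.
  by apply: measurable_funD; do ?apply: measurable_funM.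
have mh2 : measurable_fun setT
    (fun z : R * R => h (c * z.1 - s * z.2) (s * z.1 + c * z.2)).
  apply: measurable_comp2 => //; last exact: maff.
  rewrite (_ : (fun _ => _) = (fun z : R * R => c * z.1 + (- s) * z.2)).
    exact: maff.
  by apply/funext => z; rewrite mulNr.
have step1 : (`|c|%:E *
    (\int[mu]_x \int[mu]_y h (c * x - s * y)%R (s * x + c * y)%R) =
    \int[mu]_y \int[mu]_x h x (y / c + s * x / c)%R)%E.
  rewrite swap_integral//.
  rewrite -ge0_integralZl//; last 2 first.
  - exact: (@measurable_fun_fubini_tonelli_G _ _ _ _ _ mu
      (fun z => h (c * z.1 - s * z.2) (s * z.1 + c * z.2))).
  - by move=> y _; exact: integral_ge0.
  apply: eq_integral => y _.
  rewrite (@ge0_integral_affine _ c (- (s * y)) _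
    (fun x => h x (y / c + s * x / c)))//; last first.
    apply: measurable_comp2 => //; apply: measurable_funD => //.
    by apply: measurable_funM => //; exact: measurable_funM.
  congr (_ * _)%E; apply: eq_integral => x _; congr (h _ _).
  by rewrite -[y in y / c]mul1r -cs1; field.
have step2 : (\int[mu]_y \int[mu]_x h x (y / c + s * x / c)%R =
    `|c|%:E * \int[mu]_x \int[mu]_y h x y)%E.
  rewrite -(@swap_integral (fun x y => h x (y / c + s * x / c)))//.
  rewrite -ge0_integralZl//; last 2 first.
  - exact: (@measurable_fun_fubini_tonelli_F _ _ _ _ _ mu (fun z => h z.1 z.2)).
  - by move=> y _; exact: integral_ge0.
  apply: eq_integral => x _.
  rewrite (@ge0_integral_affine _ c^-1 (s * x / c) _ (h x)) ?invr_eq0//; last first.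
    by apply: measurable_comp2 => //; exact: measurable_cst.
  rewrite muleA -EFinM -normrM divff// normr1 mul1e.
  by apply: eq_integral => y _; rewrite mulrC.
have cancel (A B : \bar R) : (`|c|%:E * A = `|c|%:E * B)%E -> A = B.
  move=> /(congr1 (fun z => `|c|^-1%:E * z)%E).
  by rewrite !muleA -!EFinM !mulVf ?normr_eq0// !mul1e.
by apply: cancel; rewrite step1 step2.
Qed.

Lemma normal_pdf_rotation (x y : R) :
  phi (c * x - s * y) * phi (s * x + c * y) = phi x * phi y.
Proof.
rewrite !normal_pdfE ?oner_eq0// /normal_fun.
rewrite mulrACA [RHS]mulrACA -!expRD; congr (_ * expR _).
rewrite !subr0 -!mulrDl; congr (_ / _); rewrite -!opprD; congr (- _).
rewrite -[RHS]mul1r -cs1; ring.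
Qed.

(** The joint density depends on [x^2 + y^2] only, so the invariance of Lebesgue measure carries
    over. *)
Lemma N01_rotation (f : R -> R -> \bar R) :
  measurable_fun setT (fun z : R * R => f z.1 z.2) ->
  (forall x y, 0 <= f x y)%E ->
  (\int[N01]_x \int[N01]_y f (c * x - s * y)%R (s * x + c * y)%R =
   \int[N01]_x \int[N01]_y f x y)%E.
Proof.
have mphi : measurable_fun setT phi by exact: measurable_normal_pdf.
pose pp x y := (phi x * phi y)%:E.
have density (g : R -> R -> \bar R) :
    measurable_fun setT (fun z : R * R => g z.1 z.2) ->
    (forall x y, 0 <= g x y)%E ->
    (\int[N01]_x \int[N01]_y g x y = \int[mu]_x \int[mu]_y (g x y * pp x y))%E.
  move=> mg g0; rewrite integral_N01//; last 2 first.
  - exact: (@measurable_fun_fubini_tonelli_F _ _ _ _ _ N01 (fun z => g z.1 z.2)).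
  - by move=> x; exact: integral_ge0.
  apply: eq_integral => x _.
  have mgx : measurable_fun setT (g x).
    by apply: measurable_comp2 => //; exact: measurable_cst.
  rewrite integral_N01// -ge0_integralZr//.
  - by apply: eq_integral => y _; rewrite -muleA -EFinM mulrC.
  - by apply: emeasurable_funM => //; exact/measurable_EFinP.
  - by move=> y _; rewrite mule_ge0// lee_fin normal_pdf_ge0.
  - by rewrite lee_fin normal_pdf_ge0.
move=> mf f0; rewrite [RHS]density//.
rewrite -(@lebesgue_rotation (fun x y => f x y * pp x y)%E); last 2 first.
- apply: emeasurable_funM => //; apply/measurable_EFinP/measurable_funM.
    exact: (measurableT_comp mphi).
  exact: (measurableT_comp mphi).
- by move=> x y; rewrite mule_ge0// lee_fin mulr_ge0// normal_pdf_ge0.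
have mfst : measurable_fun [set: R * R] fst by [].
have msnd : measurable_fun [set: R * R] snd by [].
rewrite (density (fun x y => f (c * x - s * y) (s * x + c * y))).
- by apply: eq_integral => x _; apply: eq_integral => y _; rewrite /pp normal_pdf_rotation.
- by apply: measurable_comp2; [|apply: measurable_funB|apply: measurable_funD];
    try exact: measurable_funM.
- by move=> x y; exact: f0.
Qed.

End plane_rotation.

Section rotate_two_coordinates.
Context {R : realType} d (T : measurableType d) (P : probability T R).
Local Notation N01 := (@normal_prob R 0 1).
Variables (I : finType) (a b : I) (ab : a != b).

Let baF : (b == a) = false. Proof. by rewrite eq_sym; exact: negbTE. Qed.

Definition put2 (x y : R) (u : I -> R) (i : I) : R :=
  if i == a then x else if i == b then y else u i.

Definition rotate2 (c s : R) (u : I -> R) : I -> R :=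
  put2 (c * u a - s * u b) (s * u a + c * u b) u.

Lemma rotate2_put2 c s x y u :
  rotate2 c s (put2 x y u) = put2 (c * x - s * y) (s * x + c * y) u.
Proof.
rewrite /rotate2 /put2 !eqxx baF.
by apply/funext => i; case: eqP => // _; case: eqP.
Qed.

Let Y (X : I -> T -> R) (i : I) (z : (R * R) * T) : R :=
  put2 z.1.1 z.1.2 (X ^~ z.2) i.

(** Coordinates [a] and [b] are overwritten by two fresh variables on their own factors, which makes
    them explicit integration variables in [integral_put2]. *)
Lemma gauss_family_put2 (X : I -> T -> R) : gauss_family P X ->
  gauss_family ((N01 \x N01) \x P)%E (Y X).
Proof.
move=> [mX lX]; split => [i|B mB].
  rewrite /Y /put2; case: (i == a); last case: (i == b).
  - by apply: (measurableT_comp measurable_fst); exact: measurable_fst.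
  - by apply: (measurableT_comp measurable_snd); exact: measurable_fst.
  - exact: (measurableT_comp (mX i) measurable_snd).
pose B' i := if (i == a) || (i == b) then setT else B i.
have mB' i : measurable (B' i) by rewrite /B'; case: ifP.
transitivity (N01 (B a) * N01 (B b) * P [set w | forall i, B' i (X i w)])%E.
  rewrite (_ : mkset _ = (B a `*` B b) `*` [set w | forall i, B' i (X i w)]).
    rewrite -[X in (X * _)%E](product_measure1E N01 N01 (mB a) (mB b)).
    apply: product_measure1E; last exact: box_measurable.
    by apply: (@measurableX _ _ (measurableTypeR R) (measurableTypeR R)); exact: mB.
  rewrite predeqE => z; split=> [Bz|[[Ba Bb] Bz] i].
    split; [split|].
    - by have := Bz a; rewrite /Y /put2 eqxx.
    - by have := Bz b; rewrite /Y /put2 eqxx baF.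
    - move=> i; rewrite /B'; have := Bz i; rewrite /Y /put2.
      by case: eqP => //=; case: eqP.
  rewrite /Y /put2; case: eqP => [->//|/eqP/negbTE ia].
  case: eqP => [->//|/eqP/negbTE ib].
  by have := Bz i; rewrite /B' ia ib.
rewrite (lX _ mB') [RHS](bigD1 a)//= [in RHS](bigD1 b)/=; last by rewrite eq_sym.
rewrite [in LHS](bigD1 a)//= [in LHS](bigD1 b)/=; last by rewrite eq_sym.
rewrite {1 2}/B' !eqxx orbT/= probability_setT !mul1e -muleA.
congr (_ * (_ * _))%E; apply: eq_bigr => i /andP[/negbTE ia /negbTE ib].
by rewrite /B' ia ib.
Qed.

Lemma integral_put2 (X : I -> T -> R) (F : (I -> R) -> \bar R) :
  gauss_family P X -> borel_fun F -> (forall x, 0 <= F x)%E ->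
  (\int[P]_w F (X ^~ w) =
   \int[N01]_x \int[N01]_y \int[P]_w F (put2 x y (X ^~ w)))%E.
Proof.
move=> gX mF F0; have gY := gauss_family_put2 gX.
have mFY : measurable_fun setT (fun z => F ((Y X) ^~ z)) by apply: mF; case: gY.
rewrite (gauss_family_same_law gX gY mF F0) fubini_tonelli1// fubini_tonelli1//.
  exact: (@measurable_fun_fubini_tonelli_F _ _ _ _ _ P (fun z => F ((Y X) ^~ z))).
by move=> z; exact: integral_ge0.
Qed.

(** Tested on the indicator of a box: by [integral_put2] the other coordinates are integrated out
    first, and [N01_rotation] applies to the resulting function of the two rotated ones. *)
Lemma gauss_family_rotate2 (c s : R) (X : I -> T -> R) :
  c ^+ 2 + s ^+ 2 = 1 -> gauss_family P X ->
  gauss_family P (fun i w => rotate2 c s (X ^~ w) i).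
Proof.
move=> cs1 gX; have [mX lX] := gX.
have mrot d' (T' : measurableType d') (Z : I -> T' -> R) :
    (forall i, measurable_fun setT (Z i)) ->
    forall i, measurable_fun setT (fun w => rotate2 c s (Z ^~ w) i).
  move=> mZ i; rewrite /rotate2 /put2; case: (i == a); last case: (i == b).
  - by apply: measurable_funB; exact: measurable_funM.
  - by apply: measurable_funD; exact: measurable_funM.
  - exact: mZ.
split; first exact: mrot.
move=> B mB; rewrite -(lX _ mB).
pose F (u : I -> R) : \bar R := (\1_[set u : I -> R | forall i, B i (u i)] u)%:E.
have F0 u : (0 <= F u)%E by rewrite lee_fin.
have mF : borel_fun F.
  move=> d' T' Z mZ; apply/measurable_EFinP.
  rewrite (_ : (fun _ => _) = \1_[set w | forall i, B i (Z i w)]).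
    by apply: measurable_indic; exact: box_measurable.
  by apply/funext => w; rewrite !indicE; congr (_ %:R); rewrite mem_setE.
have intF (Z : I -> T -> R) : (forall i, measurable_fun setT (Z i)) ->
    (\int[P]_w F (Z ^~ w) = P [set w | forall i, B i (Z i w)])%E.
  move=> mZ; rewrite -[in RHS](setIT (mkset _)) -integral_indic//.
  exact: box_measurable.
rewrite -(intF _ mX) -(intF _ (mrot _ _ _ mX)).
have mFr : borel_fun (F \o rotate2 c s).
  by move=> d' T' Z mZ; exact: (mF _ _ (fun i w => rotate2 c s (Z ^~ w) i) (mrot _ _ _ mZ)).
have mFY : measurable_fun setT (fun z => F ((Y X) ^~ z)).
  by apply: mF; case: (gauss_family_put2 gX).
have mH := @measurable_fun_fubini_tonelli_F _ _ _ _ _ P _ mFY (fun z => F0 _).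
have H0 (x y : R) : (0 <= \int[P]_w F (put2 x y (X ^~ w)))%E.
  exact: integral_ge0.
rewrite (integral_put2 gX mF F0) -(N01_rotation cs1 mH H0).
rewrite (integral_put2 gX mFr) => [|u]; last exact: F0.
apply: eq_integral => x _; apply: eq_integral => y _; apply: eq_integral => w _.
by rewrite /= rotate2_put2.
Qed.

End rotate_two_coordinates.

(** * Gaussian matrices and Givens rotations *)

Section gauss_matrix.
Context {R : realType} d (T : measurableType d) (P : probability T R).

Definition gauss_matrix m n (X : T -> 'M[R]_(m, n)) : Prop :=
  gauss_family P (fun (ij : 'I_m * 'I_n) w => X w ij.1 ij.2).

Lemma gauss_matrix_mxsub m n p q (f : 'I_p -> 'I_m) (g : 'I_q -> 'I_n)
    (X : T -> 'M[R]_(m, n)) :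
  injective f -> injective g ->
  gauss_matrix X -> gauss_matrix (fun w => mxsub f g (X w)).
Proof.
move=> fI gI gX.
have hI : injective (fun ij : 'I_p * 'I_q => (f ij.1, g ij.2)).
  by move=> [i j] [k l] [/fI -> /gI ->].
have := gauss_family_comp hI gX; congr (gauss_family _ _).
by apply/funext => -[i j]; apply/funext => w; rewrite /= mxE.
Qed.

Lemma gauss_matrix_tr m n (X : T -> 'M[R]_(m, n)) :
  gauss_matrix X -> gauss_matrix (fun w => (X w)^T).
Proof.
move=> gX.
have hI : injective (fun ij : 'I_n * 'I_m => (ij.2, ij.1)).
  by move=> [i j] [k l] [-> ->].
have := gauss_family_comp hI gX; congr (gauss_family _ _).
by apply/funext => -[i j]; apply/funext => w; rewrite /= mxE.
Qed.

Definition borel_matrix_set m n (S : set 'M[R]_(m, n)) : Prop :=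
  forall d' (T' : measurableType d') (X : T' -> 'M[R]_(m, n)),
    (forall i j, measurable_fun setT (fun w => X w i j)) ->
    measurable [set w | S (X w)].

Lemma gauss_matrix_split_le m n (J : 'I_m -> 'I_n -> bool)
    (X : T -> 'M[R]_(m, n)) (S : set 'M[R]_(m, n)) (c : R) :
  gauss_matrix X -> borel_matrix_set S -> 0 <= c ->
  (forall w, P [set w' | S (\matrix_(i, j) if J i j then X w i j else X w' i j)]
    <= c%:E)%E ->
  (P [set w | S (X w)] <= c%:E)%E.
Proof.
move=> gX mS c0 Sc.
pose S' := [set x : 'I_m * 'I_n -> R | S (\matrix_(i, j) x (i, j))].
have mS' : borel_set S'.
  move=> d' T' Y mY; apply: mS => i j.
  rewrite (_ : (fun _ => _) = Y (i, j)); first exact: mY.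
  by apply/funext => w; rewrite mxE.
have := gauss_family_split_le (J := fun ij => J ij.1 ij.2) gX mS' c0 Sc.
by rewrite (_ : [set w | S' _] = [set w | S (X w)])//; apply/funext => w;
  rewrite /S'/=; congr S; apply/matrixP => i j; rewrite mxE.
Qed.

(* Only the orthogonal matrices produced by Givens rotations are needed. *)
Definition rotation n (H : 'M[R]_n) : Prop :=
  H *m H^T = 1%:M /\ forall m (X : T -> 'M[R]_(m, n)),
    gauss_matrix X -> gauss_matrix (fun w => X w *m H).

Lemma rotation1 n : rotation (1%:M : 'M[R]_n).
Proof.
split=> [|m X gX]; first by rewrite trmx1 mulmx1.
by under eq_fun do rewrite mulmx1.
Qed.

Lemma rotationM n (H K : 'M[R]_n) :
  rotation H -> rotation K -> rotation (H *m K).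
Proof.
move=> [H1 Hg] [K1 Kg]; split=> [|m X gX].
  by rewrite trmx_mul mulmxA -(mulmxA H) K1 mulmx1.
by under eq_fun do rewrite mulmxA; exact/Kg/Hg.
Qed.

Definition givens n (a b : 'I_n) (c s : R) : 'M[R]_n :=
  \matrix_(i, j) if j == a then c * (i == a)%:R - s * (i == b)%:R
    else if j == b then s * (i == a)%:R + c * (i == b)%:R else (i == j)%:R.

Lemma mulmx_givens m n (a b : 'I_n) (c s : R) (A : 'M[R]_(m, n)) i j :
  (A *m givens a b c s) i j = if j == a then c * A i a - s * A i b
    else if j == b then s * A i a + c * A i b else A i j.
Proof.
have sumE (k : 'I_n) : \sum_l A i l * (l == k)%:R = A i k.
  rewrite (bigD1 k)//= eqxx mulr1 big1 ?addr0// => l /negbTE ->.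
  by rewrite mulr0.
rewrite mxE; under eq_bigr do rewrite mxE.
case: (j == a); last case: (j == b); last exact: sumE.
  rewrite -[in RHS](sumE a) -[in RHS](sumE b) !mulr_sumr -sumrB.
  by apply: eq_bigr => l _; ring.
rewrite -[in RHS](sumE a) -[in RHS](sumE b) !mulr_sumr -big_split/=.
by apply: eq_bigr => l _; ring.
Qed.

Lemma rotation_givens n (a b : 'I_n) (c s : R) : a != b ->
  c ^+ 2 + s ^+ 2 = 1 -> rotation (givens a b c s).
Proof.
move=> ab cs1; have ba : (b == a) = false by rewrite eq_sym; exact: negbTE.
split=> [|m X gX].
  (* The transpose is the rotation by the opposite angle, so orthogonality becomes a product of two
     plane rotations. *)
  have -> : (givens a b c s)^T = givens a b c (- s).
    apply/matrixP => i j; rewrite !mxE.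
    have abF := negbTE ab.
    have three k : k = a \/ k = b \/ (k == a) = false /\ (k == b) = false.
      by case: (altP (k =P a)); case: (altP (k =P b)); auto.
    have [->|[->|[ia ib]]] := three i; have [->|[->|[ja jb]]] := three j;
      rewrite ?eqxx ?ba ?abF ?ia ?ib ?ja ?jb /=; try ring.
    - by rewrite eq_sym ja/=; ring.
    - by rewrite eq_sym jb/=; ring.
    - by rewrite eq_sym ia/=; ring.
    - by rewrite eq_sym ib/=; ring.
    - by rewrite eq_sym.
  apply/matrixP => i j; rewrite mulmx_givens !mxE !eqxx ba.
  case: (eqVneq j a) => [->|ja].
    by transitivity ((c ^+ 2 + s ^+ 2) * (i == a)%:R); [ring|rewrite cs1 mul1r].
  case: (eqVneq j b) => [->|jb] //.
    by transitivity ((c ^+ 2 + s ^+ 2) * (i == b)%:R); [ring|rewrite cs1 mul1r].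
(* Only the first [k] rows have been rotated in [Y k]. Passing to [k.+1] rotates the two entries of
   row [k] in columns [a] and [b], a single instance of [gauss_family_rotate2]. *)
pose Y k w := \matrix_(i, j) if (i < k)%N then (X w *m givens a b c s) i j else X w i j.
have YE k w i j : Y k w i j =
    if (i < k)%N then (X w *m givens a b c s) i j else X w i j by rewrite mxE.
have gY k : (k <= m)%N -> gauss_matrix (Y k).
  elim: k => [_|k IHk km].
    move: gX; congr (gauss_family _ _); apply/funext => -[i j]; apply/funext => w.
    by rewrite YE ltn0.
  have kk : (Ordinal km, a) != (Ordinal km, b).
    by apply: contra ab => /eqP[->].
  have := gauss_family_rotate2 kk cs1 (IHk (ltnW km)).
  congr (gauss_family _ _); apply/funext => -[i j]; apply/funext => w.
  rewrite /rotate2 /put2/= !YE /= ltnn ltnS !xpair_eqE mulmx_givens.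
  have [->|ik] := eqVneq i (Ordinal km); first by rewrite /= leqnn ltnn.
  by rewrite /= [(i <= k)%N]leq_eqVlt -[(i : nat) == k]/(i == Ordinal km) (negbTE ik).
have := gY m (leqnn m); congr (gauss_family _ _).
apply/funext => -[i j]; apply/funext => w; by rewrite YE ltn_ord.
Qed.

End gauss_matrix.

Section sum_of_squares.
Context {R : realType}.

Definition sqn m n (A : 'M[R]_(m, n)) : R := \sum_i \sum_j A i j ^+ 2.

Lemma sqn_ge0 m n (A : 'M[R]_(m, n)) : 0 <= sqn A.
Proof. by apply: sumr_ge0 => i _; apply: sumr_ge0 => j _; exact: sqr_ge0. Qed.

Lemma sqn_mxtrace m n (A : 'M[R]_(m, n)) : sqn A = \tr (A *m A^T).
Proof.
apply: eq_bigr => i _; rewrite mxE; apply: eq_bigr => j _.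
by rewrite mxE expr2.
Qed.

Lemma sqn_tr m n (A : 'M[R]_(m, n)) : sqn A^T = sqn A.
Proof. by rewrite !sqn_mxtrace trmxK mxtrace_mulC. Qed.

Lemma sqn_orthogonal m n p (A : 'M[R]_(m, n)) (H : 'M[R]_(n, p)) :
  H *m H^T = 1%:M -> sqn (A *m H) = sqn A.
Proof.
by move=> H1; rewrite !sqn_mxtrace trmx_mul mulmxA -(mulmxA A) H1 mulmx1.
Qed.

Lemma sqn_row_mx m n p (A : 'M[R]_(m, n)) (B : 'M[R]_(m, p)) :
  sqn (row_mx A B) = sqn A + sqn B.
Proof.
rewrite /sqn -big_split/=; apply: eq_bigr => i _; rewrite big_split_ord/=.
by congr (_ + _); apply: eq_bigr => j _; rewrite ?row_mxEl ?row_mxEr.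
Qed.

Lemma sqn_scalar (a : R) : sqn (a%:M : 'M[R]_1) = a ^+ 2.
Proof. by rewrite /sqn !big_ord1 mxE eqxx. Qed.

Lemma sqn_eq0 m n (A : 'M[R]_(m, n)) : sqn A = 0 -> A = 0.
Proof.
move=> /eqP; rewrite psumr_eq0 => [/allP A0|i _]; last first.
  by apply: sumr_ge0 => j _; exact: sqr_ge0.
apply/matrixP => i j; have /eqP := A0 i (mem_index_enum i).
move=> /eqP; rewrite psumr_eq0 => [/allP/(_ j (mem_index_enum j))|k _].
  by rewrite /= sqrf_eq0 mxE => /eqP.
exact: sqr_ge0.
Qed.

End sum_of_squares.

Section rotation_to_axis.
Context {R : realType} d (T : measurableType d) (P : probability T R).

(** Givens rotations in the planes of [k] and [t], for successive [t > k], clear the entries of [v]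
    after [k] one at a time. They do not touch the columns before [k]; the last clause lets
    [rotation_triangular] keep the rows already treated. *)
Lemma rotation_row n (v : 'rV[R]_n) (k : 'I_n) :
  exists H : 'M[R]_n, [/\ rotation P H,
    forall j : 'I_n, (k < j)%N -> (v *m H) 0 j = 0 &
    forall u : 'rV[R]_n, (forall j : 'I_n, (k <= j)%N -> u 0 j = 0) ->
      u *m H = u].
Proof.
suff /(_ n (leqnn n))[H [rH vH uH]] : forall t, (t <= n)%N ->
  exists H : 'M[R]_n, [/\ rotation P H,
    forall j : 'I_n, (k < j < t)%N -> (v *m H) 0 j = 0 &
    forall u : 'rV[R]_n, (forall j : 'I_n, (k <= j)%N -> u 0 j = 0) -> u *m H = u].
  by exists H; split => // j kj; rewrite vH// kj ltn_ord.
elim=> [_|t IHt tn].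
  exists 1%:M; split=> [|j|u _]; [exact: rotation1| |by rewrite mulmx1].
  by rewrite ltn0 andbF.
have [H [rH vH uH]] := IHt (ltnW tn).
pose b := Ordinal tn; set x := (v *m H) 0 k; set y := (v *m H) 0 b.
have [tk|kt] := leqP t k.
  exists H; split => // j /andP[kj jt]; rewrite vH// kj/=; lia.
(* If both entries vanish there is no angle to choose, and the entry to be cleared is already
   zero. *)
have [r0|r0] := eqVneq (x ^+ 2 + y ^+ 2) 0.
  exists H; split => // j /andP[kj]; rewrite ltnS leq_eqVlt => /orP[/eqP jt|jt].
    have -> : j = b by exact: val_inj.
    move/eqP: r0; rewrite paddr_eq0 ?sqr_ge0// => /andP[_].
    by rewrite sqrf_eq0 => /eqP.
  by rewrite vH// kj jt.
have r_gt0 : 0 < x ^+ 2 + y ^+ 2 by rewrite lt0r r0 addr_ge0 ?sqr_ge0.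
set r := Num.sqrt (x ^+ 2 + y ^+ 2).
have rr : r ^+ 2 = x ^+ 2 + y ^+ 2 by rewrite sqr_sqrtr// ltW.
have rN0 : r != 0 by rewrite gt_eqF// sqrtr_gt0.
have kb : k != b by rewrite -val_eqE/= ltn_eqF.
(* This angle sends the pair [(x, y)] to [(r, 0)]. *)
exists (H *m givens k b (x / r) (- (y / r))); split.
- apply: rotationM => //; apply: rotation_givens => //.
  by rewrite sqrrN !exprMn -mulrDl -rr exprVn divff// expf_neq0.
- move=> j /andP[kj]; rewrite ltnS mulmxA mulmx_givens -/x -/y leq_eqVlt.
  have -> : (j == k) = false by rewrite -val_eqE/= gtn_eqF.
  have [jb _|jb] := eqVneq j b; first by field.
  move=> /orP[/eqP jt|jt]; last by rewrite vH// kj jt.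
  by case/eqP: jb; exact: val_inj.
- move=> u u0; rewrite mulmxA uH//; apply/rowP => j; rewrite mulmx_givens.
  have k0 := u0 k (leqnn k); have b0 := u0 b (ltnW kt).
  rewrite k0 b0 !mulr0 subr0 addr0.
  have [->|_] := eqVneq j k; first by rewrite k0.
  by have [->|//] := eqVneq j b; rewrite b0.
Qed.

(** Row [k] is rotated into the first [k.+1] coordinates. The earlier rows are supported before
    column [k], hence fixed, and in the end the row space lies in the first [m] coordinates. *)
Lemma rotation_triangular m n (A : 'M[R]_(m, n)) : (m <= n)%N ->
  exists H : 'M[R]_n, rotation P H /\
    forall i (j : 'I_n), (m <= j)%N -> (A *m H) i j = 0.
Proof.
move=> mn.
suff /(_ m (leqnn m))[H [rH AH]] : forall k, (k <= m)%N ->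
  exists H : 'M[R]_n, rotation P H /\
    forall (i : 'I_m) (j : 'I_n), (i < k <= j)%N -> (A *m H) i j = 0.
  by exists H; split => // i j mj; rewrite AH// ltn_ord.
elim=> [_|k IHk km].
  by exists 1%:M; split => //; exact: rotation1.
have [H [rH AH]] := IHk (ltnW km).
have kn : (k < n)%N by lia.
have [K [rK vK uK]] := rotation_row (row (Ordinal km) (A *m H)) (Ordinal kn).
exists (H *m K); split; first exact: rotationM.
move=> i j /andP[ik kj].
have -> : (A *m (H *m K)) i j = (row i (A *m H) *m K) 0 j.
  by rewrite mulmxA -row_mul [RHS]mxE.
move: ik; rewrite ltnS leq_eqVlt => /orP[/eqP ik|ik].
  have -> : i = Ordinal km by exact: val_inj.
  by rewrite vK.
by rewrite uK => [|l kl]; rewrite mxE AH// ik// ltnW.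
Qed.

End rotation_to_axis.

(** * Chi-square tails *)

Section chi_square.
Context {R : realType} d (T : measurableType d) (P : probability T R).
Local Notation N01 := (@normal_prob R 0 1).

(** Multiplying the standard density by [exp (s x^2)] gives [sg] times the centred normal density of
    variance [sg^2 = 1 / (1 - 2 s)]. *)
Lemma integral_N01_expR_sqr (s : R) : s < 2^-1 ->
  (\int[N01]_x (expR (s * x ^+ 2))%:E = (Num.sqrt (1 - 2 * s))^-1%:E)%E.
Proof.
move=> s2; have t0 : 0 < 1 - 2 * s by lra.
set sg := (Num.sqrt (1 - 2 * s))^-1.
have sg_gt0 : 0 < sg by rewrite invr_gt0 sqrtr_gt0.
have sgE : sg ^+ 2 = (1 - 2 * s)^-1 by rewrite exprVn sqr_sqrtr// ltW.
have m1 : measurable_fun setT (fun x : R => (expR (s * x ^+ 2))%:E).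
  apply/measurable_EFinP; apply: measurableT_comp => //.
  by apply: measurable_funM => //; exact: measurable_funX.
rewrite integral_N01//.
transitivity (\int[lebesgue_measure]_x (sg%:E * (normal_pdf 0 sg x)%:E))%E.
  apply: eq_integral => x _; rewrite -!EFinM; congr EFin.
  rewrite !normal_pdfE ?oner_eq0 ?gt_eqF// /normal_fun /normal_peak.
  rewrite [LHS]mulrCA -expRD [RHS]mulrA sgE expr1n mul1r; congr (_ * expR _); last first.
    by rewrite !subr0; field; rewrite gt_eqF.
  rewrite -mulrnAr sqrtrM ?invr_ge0 ?(ltW t0)// -sgE sqrtr_sqr gtr0_norm//.
  by rewrite invfM mulrA divff ?mul1r// gt_eqF.
rewrite ge0_integralZl//.
- by rewrite integral_normal_pdf mule1.
- by apply/measurable_EFinP; exact: measurable_normal_pdf.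
- by move=> x _; rewrite lee_fin normal_pdf_ge0.
- by rewrite lee_fin ltW.
Qed.

Lemma gauss_family_integral1 (I : finType) (X : I -> T -> R) (i : I)
    (f : R -> \bar R) :
  gauss_family P X -> measurable_fun setT f -> (forall x, 0 <= f x)%E ->
  (\int[P]_w f (X i w) = \int[N01]_x f x)%E.
Proof.
move=> gX mf f0.
have hI : injective (fun _ : 'I_1 => i) by move=> k l _; rewrite !ord1.
have gi := gauss_family_comp hI gX.
have gN : gauss_family N01 (fun (_ : 'I_1) (x : R) => x).
  split=> [_|B mB]; first exact: measurable_id.
  rewrite big_ord1; congr (N01 _); rewrite predeqE => x.
  by split=> [/(_ ord0)//|Bx k]; rewrite ord1.
apply: (gauss_family_same_law (F := fun x => f (x ord0)) gi gN) => //.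
by move=> d' T' Y mY; exact: (measurableT_comp mf (mY ord0)).
Qed.

(** Induction on the list: [gauss_family_split] freezes the head coordinate, whose factor then
    leaves the inner integral. *)
Lemma gauss_family_mgf_sqr (I : finType) (X : I -> T -> R) (s : R) (r : seq I) :
  s < 2^-1 -> uniq r -> gauss_family P X ->
  (\int[P]_w (expR (s * \sum_(i <- r) X i w ^+ 2))%:E =
   ((Num.sqrt (1 - 2 * s))^-1 ^+ size r)%:E)%E.
Proof.
move=> s2 + gX; have mX := gX.1.
have mE (r' : seq I) : borel_fun (fun x => (expR (s * \sum_(i <- r') x i ^+ 2))%:E : \bar R).
  move=> d' T' Y mY; apply/measurable_EFinP; apply: measurableT_comp => //.
  apply: measurable_funM => //; apply: measurable_sum => i.
  exact: measurable_funX.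
elim: r => [_|i r IHr /= /andP[ir ur]].
  under eq_integral do rewrite big_nil mulr0 expR0.
  rewrite integral_cst// [X in (1 * X)%E](_ : _ = 1%E) ?mule1 ?expr0//.
  exact: probability_setT.
rewrite (gauss_family_split (pred1 i) gX (mE (i :: r))) => [|x]; last first.
  by rewrite lee_fin expR_ge0.
have sg0 : 0 <= (Num.sqrt (1 - 2 * s))^-1 by rewrite invr_ge0 sqrtr_ge0.
transitivity (\int[P]_w ((expR (s * X i w ^+ 2))%:E *
    ((Num.sqrt (1 - 2 * s))^-1 ^+ size r)%:E))%E.
  apply: eq_integral => w _; rewrite -IHr// -ge0_integralZl//.
  - apply: eq_integral => w' _; rewrite -EFinM -expRD -mulrDr big_cons /= eqxx.
    congr (expR (s * (_ + _)))%:E; rewrite big_seq [RHS]big_seq.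
    by apply: eq_bigr => j jr; rewrite /= ifN//; apply: contraNneq ir => <-.
  - exact: mE.
have m1 : measurable_fun setT (fun x : R => (expR (s * x ^+ 2))%:E).
  apply/measurable_EFinP; apply: measurableT_comp => //.
  by apply: measurable_funM => //; exact: measurable_funX.
have m2 := measurableT_comp m1 (mX i).
have sgn0 : (0 <= ((Num.sqrt (1 - 2 * s))^-1 ^+ size r)%:E)%E.
  by rewrite lee_fin exprn_ge0.
rewrite (ge0_integralZr P measurableT m2 _ sgn0)//; last first.
  by move=> w _; exact: expR_ge0.
rewrite (gauss_family_integral1 i (f := fun x => (expR (s * x ^+ 2))%:E) gX m1)//.
by rewrite integral_N01_expR_sqr// -EFinM exprS.
Qed.

Lemma expR_markov (Z : T -> R) : measurable_fun setT Z ->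
  (P [set w | (0 <= Z w)%R] <= \int[P]_w (expR (Z w))%:E)%E.
Proof.
move=> mZ.
have mA : measurable [set w | 0 <= Z w].
  have := mZ measurableT _ (measurable_itv `[0, +oo[); rewrite setTI.
  by congr measurable; apply/seteqP; split=> w /=; rewrite in_itv/= andbT.
have mE : measurable_fun setT (fun w => (expR (Z w))%:E).
  by apply/measurable_EFinP; exact: measurableT_comp.
rewrite -[leLHS]mul1e -integral_cst//.
apply: (@le_trans _ _ (\int[P]_(w in [set w | (0 <= Z w)%R]) (expR (Z w))%:E)%E).
  apply: ge0_le_integral => //.
  - exact: (measurable_funS measurableT).
  - by move=> w /= Zw; rewrite lee_fin -expR0 ler_expR.
by apply: ge0_subset_integral.
Qed.

(** After squaring, it follows from [(1 + 2 s + 8 s^2) (1 - 2 s) = 1 + 4 s^2 (1 - 4 s) >= 1] and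
    [1 + x <= exp x]. *)
Lemma invsqrt_expR (s : R) (n : nat) : s <= 4^-1 ->
  (Num.sqrt (1 - 2 * s))^-1 ^+ n <= expR (n%:R * (s + 4 * s ^+ 2)).
Proof.
move=> s4; have t0 : 0 < 1 - 2 * s by lra.
rewrite [n%:R * _]mulrC expRM_natr; apply: lerXn2r; rewrite ?nnegrE ?invr_ge0 ?sqrtr_ge0 ?expR_ge0//.
rewrite -ler_sqr ?nnegrE ?invr_ge0 ?sqrtr_ge0 ?expR_ge0// exprVn sqr_sqrtr ?(ltW t0)//.
rewrite -expRM_natr -[leLHS]mul1r ler_pdivrMr//.
have e1 : 1 + (2 * s + 8 * s ^+ 2) <= expR ((s + 4 * s ^+ 2) * 2).
  by apply: le_trans (expR_ge1Dx _); lra.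
apply: le_trans (ler_wpM2r (ltW t0) e1).
have -> : (1 + (2 * s + 8 * s ^+ 2)) * (1 - 2 * s) =
  1 + 4 * s ^+ 2 * (1 - 4 * s) by ring.
rewrite lerDl mulr_ge0 ?subr_ge0 //; last by lra.
by rewrite mulr_ge0// sqr_ge0.
Qed.

(** Exponential Markov inequality; positive [s] controls the upper tail and negative [s] the lower
    one. *)
Lemma chi_square_chernoff (I : finType) (X : I -> T -> R) (s t : R) :
  s <= 4^-1 -> gauss_family P X ->
  (P [set w | (0 <= s * (\sum_i X i w ^+ 2 - #|I|%:R) - t)%R] <=
   (expR (4 * #|I|%:R * s ^+ 2 - t))%:E)%E.
Proof.
move=> s4 gX; have mX := gX.1.
have mS : measurable_fun setT (fun w => \sum_i X i w ^+ 2).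
  by apply: measurable_sum => i; exact: measurable_funX.
apply: (le_trans (expR_markov _)).
  by apply: measurable_funB => //; apply: measurable_funM => //; exact: measurable_funB.
have s2 : s < 2^-1 by lra.
set N := #|I|.
have mE : measurable_fun setT (fun w => (expR (s * \sum_i X i w ^+ 2))%:E).
  apply/measurable_EFinP; apply: measurableT_comp => //.
  exact: measurable_funM.
have -> : (\int[P]_w (expR (s * (\sum_i X i w ^+ 2 - N%:R) - t)%R)%:E =
    (expR (- (s * N%:R) - t))%:E * \int[P]_w (expR (s * \sum_i X i w ^+ 2))%:E)%E.
  rewrite -ge0_integralZl//.
  by apply: eq_integral => w _; rewrite -EFinM -expRD; congr (expR _)%:E; ring.
have := gauss_family_mgf_sqr s2 (enum_uniq I) gX.
under eq_integral do rewrite big_enum/=.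
move=> ->; rewrite -cardE -/N -EFinM lee_fin.
apply: (le_trans (ler_wpM2l (expR_ge0 _) (invsqrt_expR N s4))).
by rewrite -expRD ler_expR; lra.
Qed.

Lemma chi_square_tail (I : finType) (X : I -> T -> R) (n : nat) (t : R) :
  (#|I| <= n)%N -> 0 < t <= 1 -> gauss_family P X ->
  (P [set w | (t * n%:R < `|\sum_i X i w ^+ 2 - #|I|%:R|)%R] <=
   (2 * expR (- (t ^+ 2 * n%:R / 16)))%:E)%E.
Proof.
move=> In /andP[t0 t1] gX; have mX := gX.1.
have mS : measurable_fun setT (fun w => \sum_i X i w ^+ 2).
  by apply: measurable_sum => i; exact: measurable_funX.
have IN : (#|I|%:R : R) <= n%:R by rewrite ler_nat.
set b := expR _.
(* With [s = t / 8] or [s = - t / 8] the exponent is at most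
   [4 n (t / 8)^2 - t^2 n / 8 = - t^2 n / 16]. *)
have half (s : R) : s <= 4^-1 -> s ^+ 2 = (t / 8) ^+ 2 ->
  (P [set w | (0 <= s * (\sum_i X i w ^+ 2 - #|I|%:R) - t / 8 * (t * n%:R))%R]
    <= b%:E)%E.
  move=> s4 s2; apply: (le_trans (chi_square_chernoff _ s4 gX)).
  rewrite lee_fin ler_expR s2.
  suff : 4 * #|I|%:R * (t / 8) ^+ 2 <= 4 * n%:R * (t / 8) ^+ 2 by lra.
  by rewrite ler_wpM2r ?sqr_ge0// ler_wpM2l.
pose mset' (s u : R) :=
  [set w | 0 <= s * (\sum_i X i w ^+ 2 - #|I|%:R) - u].
have mset s u : measurable (mset' s u).
  have mZ : measurable_fun setT (fun w => s * (\sum_i X i w ^+ 2 - #|I|%:R) - u).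
    by apply: measurable_funB => //; apply: measurable_funM => //; exact: measurable_funB.
  have := mZ measurableT _ (measurable_itv `[0, +oo[); rewrite setTI.
  by congr measurable; apply/seteqP; split=> w /=; rewrite in_itv/= andbT.
have h1 : t / 8 <= 4^-1 by lra.
have h2 : - (t / 8) <= 4^-1 by lra.
have b1 := half _ h1 erefl.
have b2 := half _ h2 (sqrrN _).
rewrite mulr2n mulrDl !mul1r EFinD.
apply: le_trans (leeD b1 b2).
have mU := measureU2 P (mset (t / 8) (t / 8 * (t * n%:R)))
  (mset (- (t / 8)) (t / 8 * (t * n%:R))).
apply: le_trans mU; apply: le_measure; rewrite ?inE.
- rewrite (_ : mkset _ = ~` (mset' 1 (- (t * n%:R)) `&` mset' (-1) (- (t * n%:R)))).
    by apply: measurableC; apply: measurableI; exact: mset.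
  rewrite predeqE => w; rewrite /mset' /= !mul1r mulN1r !opprK.
  move: (\sum_i _ - _) (t * n%:R) => z u; rewrite ltNge ler_norml.
  split=> [/negP h [k1 k2]|h].
    by apply: h; apply/andP; split; lra.
  by apply/negP => /andP[k1 k2]; apply: h; split; lra.
- exact: measurableU.
move=> w /=; set z := _ - _ => tz.
have [z0|z0] := leP 0 z.
  left; rewrite ger0_norm// in tz.
  by rewrite /mset' /= -/z subr_ge0 ler_pM2l ?divr_gt0// ltW.
right; rewrite ltr0_norm// in tz.
by rewrite /mset' /= -/z mulNr -mulrN subr_ge0 ler_pM2l ?divr_gt0// ltW.
Qed.

End chi_square.

(** * The smallest singular value *)

Section existential_events.
Context {R : realType}.

Lemma nbhs_rat (x : R) (A : set R) : nbhs x A -> exists r : rat, A (ratr r).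
Proof.
move=> xA; have := @dense_rat R (A°); rewrite /dense.
move=> /(_ (ex_intro _ x xA) (@open_interior _ A)).
by case=> y [/interior_subset Ay [r _ ry]]; exists r; rewrite ry.
Qed.

Lemma nbhs_rat_mx m n (x : 'M[R]_(m, n)) (A : set 'M[R]_(m, n)) :
  nbhs x A -> exists q : 'M[rat]_(m, n), A (map_mx ratr q).
Proof.
move=> [B xB BA].
have /choice[f Bf] (ij : 'I_m * 'I_n) : exists r : rat, B ij.1 ij.2 (ratr r).
  exact: nbhs_rat (xB _ _).
exists (\matrix_(i, j) f (i, j)); apply: BA => i j.
by rewrite !mxE; exact: (Bf (i, j)).
Qed.

(** For fixed [w] the solutions [x] form an open set, which contains a rational matrix as soon as it
    is nonempty; the union over [x] becomes countable. *)
Lemma measurable_exists_lt0 m n d (T : measurableType d)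
    (Q : 'M[R]_(m, n) -> T -> R) :
  (forall x, measurable_fun setT (Q x)) ->
  (forall w, continuous (Q ^~ w)) ->
  measurable [set w | exists x, Q x w < 0].
Proof.
move=> mQ cQ.
pose A k := if unpickle k is Some q
  then [set w | Q (map_mx ratr (q : 'M[rat]_(m, n))) w < 0] else set0.
rewrite (_ : mkset _ = \bigcup_k A k).
  apply: bigcupT_measurable => k; rewrite /A; case: (unpickle k) => // q.
  have := mQ (map_mx ratr q) measurableT _ (measurable_itv `]-oo, 0[).
  by rewrite setTI; congr measurable.
rewrite predeqE => w; split=> [[x Qx]|[k _]]; last first.
  by rewrite /A; case: (unpickle k) => // q; exists (map_mx ratr q).
have : nbhs x [set y | Q y w < 0].
  exact: (cvgr_lt (Q x w) (cQ w x) 0 Qx).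
by move=> /nbhs_rat_mx[q Qq]; exists (pickle q) => //; rewrite /A pickleK.
Qed.

Lemma continuous_big_sum (V : topologicalType) (I : Type) (r : seq I)
    (Q : pred I) (f : I -> V -> R) :
  (forall i, continuous (f i)) ->
  continuous (fun x => \sum_(i <- r | Q i) f i x).
Proof.
move=> cf x; elim: r => [|i r IHr].
  under eq_fun do rewrite big_nil; exact: cvg_cst.
under eq_fun do rewrite big_cons; case: (Q i) => //.
by apply: cvgD; [exact: cf|exact: IHr].
Qed.

Lemma continuous_sqr (V : topologicalType) (f : V -> R) :
  continuous f -> continuous (fun x => f x ^+ 2).
Proof. by move=> cf x; apply: cvgM; exact: cf. Qed.

Lemma continuous_mulr (V : topologicalType) (f : V -> R) (c : R) :
  continuous f -> continuous (fun x => f x * c).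
Proof. by move=> cf x; apply: cvgM; [exact: cf|exact: cvg_cst]. Qed.

Lemma continuous_sqn (V : topologicalType) m n (f : V -> 'M[R]_(m, n)) :
  (forall i j, continuous (fun x => f x i j)) -> continuous (fun x => sqn (f x)).
Proof.
move=> cf; apply: continuous_big_sum => i; apply: continuous_big_sum => j.
exact: continuous_sqr.
Qed.

Lemma continuous_mulmxr m n p (A : 'M[R]_(n, p)) i k :
  continuous (fun x : 'M[R]_(m, n) => (x *m A) i k).
Proof.
have cx j : continuous (fun x : 'M[R]_(m, n) => x i j).
  move=> x; exact: (@coord_continuous R m n i j x).
under eq_fun do rewrite mxE; apply: continuous_big_sum => j.
exact: continuous_mulr.
Qed.

Lemma measurable_sqn d (T : measurableType d) m n (f : T -> 'M[R]_(m, n)) :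
  (forall i j, measurable_fun setT (fun w => f w i j)) ->
  measurable_fun setT (fun w => sqn (f w)).
Proof.
move=> mf; apply: measurable_sum => i; apply: measurable_sum => j.
exact: measurable_funX.
Qed.

Lemma measurable_mulmxl d (T : measurableType d) m n p (x : 'M[R]_(m, n))
    (f : T -> 'M[R]_(n, p)) :
  (forall i j, measurable_fun setT (fun w => f w i j)) ->
  forall i j, measurable_fun setT (fun w => (x *m f w) i j).
Proof.
move=> mf i j; under eq_fun do rewrite mxE; apply: measurable_sum => k.
exact: measurable_funM.
Qed.

End existential_events.

(** * One step of the bidiagonalization *)

Section tridiagonal_step.
Context {R : realType}.

(* The square of the first coordinate, and 0 when [p = 0]. *)
Definition head_sqr p (x : 'rV[R]_p) : R := \sum_(i | val i == 0%N) x 0 i ^+ 2.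

Lemma head_sqr_ge0 p (x : 'rV[R]_p) : 0 <= head_sqr x.
Proof. by apply: sumr_ge0 => i _; exact: sqr_ge0. Qed.

Lemma head_sqrS p (x : 'rV[R]_p.+1) : head_sqr x = x 0 0 ^+ 2.
Proof. by rewrite /head_sqr (big_pred1 0). Qed.

Lemma sqr_mul_head p (y v : 'rV[R]_p) :
  (forall j : 'I_p, (0 < j)%N -> v 0 j = 0) ->
  ((y *m v^T) 0 0) ^+ 2 = sqn v * head_sqr y.
Proof.
case: p y v => [|p] y v v0.
  by rewrite mxE big_ord0 /head_sqr big_ord0 mulr0 expr0n.
rewrite head_sqrS mxE big_ord_recl /= mxE big1 ?addr0 => [|j _]; last first.
  by rewrite mxE v0// mulr0.
rewrite /sqn big_ord1 big_ord_recl big1 ?addr0 ?exprMn 1?mulrC// => j _.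
by rewrite v0// expr0n.
Qed.

Lemma continuous_lincomb (V : topologicalType) (f g h : V -> R) (a b : R) :
  continuous f -> continuous g -> continuous h ->
  continuous (fun x => f x - (a * g x + b * h x)).
Proof.
move=> cf cg ch x; apply: cvgB; first exact: cf.
by apply: cvgD; apply: cvgM; first [exact: cvg_cst|exact: cg|exact: ch].
Qed.

(** Its negation says that [G G^T - L I - c E] is positive semidefinite, where [E] projects to the
    first coordinate. The weight [c] carries the cross term of the tridiagonal form from one step to
    the next. *)
Definition small_form p q (L c : R) (G : 'M[R]_(p, q)) : Prop :=
  exists x : 'rV_p, sqn (x *m G) < L * sqn x + c * head_sqr x.

Lemma borel_small_form p q (L c : R) : borel_matrix_set (@small_form p q L c).
Proof.
move=> d T X mX.
pose Q (x : 'rV[R]_p) w := sqn (x *m X w) - (L * sqn x + c * head_sqr x).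
rewrite (_ : mkset _ = [set w | exists x, Q x w < 0]).
  apply: measurable_exists_lt0 => [x|w].
    apply: measurable_funB => //.
    by apply: measurable_sqn; exact: measurable_mulmxl.
  have cx i j : continuous (fun x : 'rV[R]_p => x i j).
    move=> x; exact: (@coord_continuous R 1 p i j x).
  have c1 : continuous (fun x : 'rV[R]_p => sqn (x *m X w)).
    by apply: continuous_sqn => i j; exact: continuous_mulmxr.
  have c2 : continuous (fun x : 'rV[R]_p => sqn x) by exact: continuous_sqn.
  have c3 : continuous (@head_sqr p).
    by apply: continuous_big_sum => i; exact: continuous_sqr.
  exact: continuous_lincomb.
by rewrite predeqE => w; split=> -[x]; rewrite /Q ?subr_lt0 => Qx; exists x;
  rewrite ?subr_lt0.
Qed.

(* Gershgorin's estimate for one 2 x 2 block of the tridiagonal matrix: the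
   cross term [2 t r u] costs at most [a b (t^2 + z)]. *)
Lemma two_by_two_bound (a b t u z : R) : 0 <= a -> 0 <= b -> 0 <= z ->
  u ^+ 2 = b ^+ 2 * z ->
  forall r, r ^+ 2 = a ^+ 2 ->
  (a ^+ 2 - a * b) * t ^+ 2 + (b ^+ 2 - a * b) * z <= (t * r + u) ^+ 2.
Proof.
move=> a0 b0 z0 uz r ra.
have z2 : z = Num.sqrt z ^+ 2 by rewrite sqr_sqrtr.
set y := Num.sqrt z in z2.
have y0 : 0 <= y by exact: sqrtr_ge0.
have tru : `|t * r * u| = a * b * (`|t| * y).
  rewrite !normrM; have -> : `|r| = a.
    by apply/eqP; rewrite -(@eqrXn2 _ 2)// real_normK ?num_real// ra.
  have -> : `|u| = b * y.
    apply/eqP; rewrite -(@eqrXn2 _ 2)// ?mulr_ge0// real_normK ?num_real// uz.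
    by rewrite exprMn -z2.
  ring.
have h1 : - (a * b * (`|t| * y)) <= t * r * u.
  by rewrite lerNl (le_trans (ler_norm _))// normrN tru.
have h2 : `|t| * y * 2 <= t ^+ 2 + z.
  rewrite z2 -[t ^+ 2]real_normK ?num_real//.
  have := sqr_ge0 (`|t| - y); lra.
have ab0 : 0 <= a * b by rewrite mulr_ge0.
have h3 := ler_wpM2l ab0 h2.
have -> : (t * r + u) ^+ 2 = t ^+ 2 * r ^+ 2 + 2 * (t * r * u) + u ^+ 2 by ring.
rewrite ra uz; lra.
Qed.

(* One step of the bidiagonalization: the first row has been rotated to
   [(r, 0, .., 0)] and [K] rotates the rest of the first column to its first
   coordinate. *)
Lemma small_form_step p q (L c c' r a b : R) (v : 'cV[R]_p) (B : 'M[R]_(p, q))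
    (K : 'M[R]_p) :
  K *m K^T = 1%:M -> (forall j : 'I_p, (0 < j)%N -> (v^T *m K) 0 j = 0) ->
  0 <= a -> 0 <= b -> r ^+ 2 = a ^+ 2 -> sqn v = b ^+ 2 ->
  a * b - b ^+ 2 <= c -> L + c' <= a ^+ 2 - a * b ->
  small_form L c' (col_mx (row_mx r%:M 0) (row_mx v B) : 'M[R]_(1 + p, 1 + q)) ->
  small_form L c (K^T *m B).
Proof.
move=> KK vK a0 b0 ra vb abc Lab [x].
rewrite -[x]hsubmxK; move: (lsubmx x) (rsubmx x) => {x} x1 x2.
rewrite [x1]mx11_scalar; set t := x1 0 0.
rewrite mul_row_col !mul_mx_row mulmx0 -scalar_mxM add_row_mx add0r.
rewrite !sqn_row_mx sqn_scalar -/t head_sqrS.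
have -> : row_mx (t%:M : 'M[R]_1) x2 0 0 = t.
  have -> : (0 : 'I_(1 + p)) = lshift p 0 by exact: val_inj.
  by rewrite row_mxEl mxE eqxx mulr1n.
set u := (x2 *m v) 0 0.
have -> : (t * r)%:M + x2 *m v = (t * r + u)%:M.
  by rewrite [x2 *m v]mx11_scalar -/u raddfD.
rewrite sqn_scalar => lt1.
have x2E : x2 = x2 *m K *m K^T by rewrite -mulmxA KK mulmx1.
have K1 : K^T *m K^T^T = 1%:M by rewrite trmxK (mulmx1C KK).
(* In the rotated basis [v] lies on the first axis, so its product with [x2] sees only the first
   coordinate of [x2 *m K], which is also the witness for the smaller block. *)
have uE : u ^+ 2 = b ^+ 2 * head_sqr (x2 *m K).
  rewrite -vb -[sqn v]sqn_tr -(sqn_orthogonal _ KK) -sqr_mul_head//.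
  by rewrite trmx_mul trmxK mulmxA -x2E.
exists (x2 *m K).
rewrite (sqn_orthogonal _ KK) mulmxA -x2E.
have := two_by_two_bound t a0 b0 (head_sqr_ge0 _) uE ra.
have := ler_wpM2r (head_sqr_ge0 (x2 *m K)) abc.
have := ler_wpM2r (sqr_ge0 t) Lab.
move: lt1; set z := head_sqr _; lra.
Qed.

End tridiagonal_step.

(** * Numerical constants of the recursion *)

Section spectral_edge_constants.
Context {R : realType}.
Implicit Types (n m p q : nat) (e : R).

(* For row and column norms [a ~ sqrt q.+1] and [b ~ sqrt p], the recursion
   needs a weight at least [a b - b^2] for the p x q block; the term in [e]
   absorbs fluctuations of [a^2] and [b^2] of size [e^2 n]. *)
Definition head_weight n e p q : R :=
  Num.sqrt q.+1%:R * Num.sqrt p%:R - p%:R + 4 * e * n%:R.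

(* Gershgorin's bound is smallest on the first row of the m x n matrix, where
   it is about [(sqrt n - sqrt m)^2]. *)
Definition edge_level n m e : R :=
  (Num.sqrt n.+1%:R - Num.sqrt m%:R) ^+ 2 - 1 - 8 * e * n%:R.

Lemma head_weight_ge0 n e p q : 0 <= e -> (p <= q)%N -> 0 <= head_weight n e p q.
Proof.
move=> e0 pq; rewrite addr_ge0 ?mulr_ge0// subr_ge0.
rewrite -[leLHS](@sqr_sqrtr _ p%:R)// expr2 ler_wpM2r ?sqrtr_ge0// ler_wsqrtr//.
by rewrite ler_nat leqW.
Qed.

Lemma le_sqrt_add (a A e : R) n : 0 <= a -> 0 <= e -> 0 <= A ->
  `|a ^+ 2 - A| <= e ^+ 2 * n%:R -> a <= Num.sqrt A + e * Num.sqrt n%:R.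
Proof.
move=> a0 e0 A0 /ler_normlW aA.
have r0 : 0 <= Num.sqrt A + e * Num.sqrt n%:R.
  by rewrite addr_ge0 ?mulr_ge0 ?sqrtr_ge0.
rewrite -ler_sqr ?nnegrE// sqrrD exprMn !sqr_sqrtr//.
have : 0 <= Num.sqrt A * (e * Num.sqrt n%:R) by rewrite !mulr_ge0 ?sqrtr_ge0.
lra.
Qed.

(** Expanding the product of the two bounds from [le_sqrt_add] leaves three error terms, each at
    most [e n]. *)
Lemma le_mul_sqrt_add (a b A B e : R) n : 0 <= a -> 0 <= b -> 0 <= e <= 1 ->
  0 <= A <= n%:R -> 0 <= B <= n%:R ->
  `|a ^+ 2 - A| <= e ^+ 2 * n%:R -> `|b ^+ 2 - B| <= e ^+ 2 * n%:R ->
  a * b <= Num.sqrt A * Num.sqrt B + 3 * e * n%:R.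
Proof.
move=> a0 b0 /andP[e0 e1] /andP[A0 An] /andP[B0 Bn] aA bB.
have la := le_sqrt_add a0 e0 A0 aA.
have lb := le_sqrt_add b0 e0 B0 bB.
apply: (le_trans (ler_pM a0 b0 la lb)).
have sA : Num.sqrt A <= Num.sqrt n%:R :> R by rewrite ler_wsqrtr.
have sB : Num.sqrt B <= Num.sqrt n%:R :> R by rewrite ler_wsqrtr.
have n2 : (n%:R : R) = Num.sqrt n%:R ^+ 2 by rewrite sqr_sqrtr.
have s0 : 0 <= Num.sqrt n%:R :> R by exact: sqrtr_ge0.
set sn : R := Num.sqrt n%:R in sA sB n2 s0 *; rewrite n2.
have es0 : 0 <= e * sn by rewrite mulr_ge0.
have h1 := ler_wpM2l es0 sA; have h2 := ler_wpM2l es0 sB.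
have h3 : e * sn ^+ 2 * e <= e * sn ^+ 2.
  by rewrite ler_piMr// mulr_ge0// sqr_ge0.
lra.
Qed.

Lemma sqr_near_le1 (e : R) n : 0 <= e <= 1 -> e ^+ 2 * n%:R <= e * n%:R.
Proof. by move=> /andP[e0 e1]; rewrite ler_wpM2r// expr2 ler_piMr. Qed.

(** The condition [L + c' <= a^2 - a b] of [small_form_step] at the nominal values [a^2 = q + 1] and
    [b^2 = p], with [4 e n] to spare. Since [q - p = n - m], the differences of squares [U^2 - V^2]
    and [U'^2 - V'^2] agree; the smaller sum [U + V] forces the larger gap [U - V]. The [- 1] in
    [edge_level] pays for [U^2] being [q + 2]. *)
Lemma edge_level_step n m e p q : (p.+1 <= m)%N -> (m <= n)%N ->
  (q + m = p + n)%N ->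
  edge_level n m e + head_weight n e p.+1 q.+1 <=
  q.+1%:R - Num.sqrt q.+1%:R * Num.sqrt p%:R - 4 * e * n%:R.
Proof.
move=> pm mn qmpn; rewrite /edge_level /head_weight.
set U : R := Num.sqrt q.+2%:R; set V : R := Num.sqrt p.+1%:R.
set U' : R := Num.sqrt n.+1%:R; set V' : R := Num.sqrt m%:R.
have UU : U ^+ 2 = q%:R + 2 by rewrite sqr_sqrtr// -natr1 -natr1; ring.
have VV : V ^+ 2 = p%:R + 1 by rewrite sqr_sqrtr// -natr1.
have UU' : U' ^+ 2 = n%:R + 1 by rewrite sqr_sqrtr// -natr1.
have VV' : V' ^+ 2 = m%:R by rewrite sqr_sqrtr.
have qmpnR : q%:R + m%:R = p%:R + n%:R :> R by rewrite -!natrD qmpn.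
have U0 : 0 < U by rewrite sqrtr_gt0.
have V0 : 0 <= V by exact: sqrtr_ge0.
have VV'le : V <= V' by rewrite ler_wsqrtr// ler_nat.
have UU'le : U <= U' by rewrite ler_wsqrtr// ler_nat; lia.
have V'U' : V' <= U' by rewrite ler_wsqrtr// ler_nat; lia.
have gap : U' - V' <= U - V.
  rewrite -(@ler_pM2r _ (U + V)); last by rewrite ltr_wpDr.
  have -> : (U - V) * (U + V) = (U' - V') * (U' + V').
    by rewrite -!subr_sqr UU VV UU' VV'; lra.
  by rewrite ler_wpM2l ?subr_ge0// lerD.
have gap2 : (U' - V') ^+ 2 <= (U - V) ^+ 2.
  by rewrite ler_sqr ?nnegrE ?subr_ge0//; move: gap V'U'; lra.
have UV : Num.sqrt q.+1%:R * Num.sqrt p%:R <= U * V.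
  by rewrite ler_pM ?sqrtr_ge0// ler_wsqrtr// ler_nat.
have q1 : (q.+1%:R : R) = q%:R + 1 by rewrite -natr1.
have p1 : (p.+1%:R : R) = p%:R + 1 by rewrite -natr1.
rewrite q1 p1 in UV *.
have UV2 : (U - V) ^+ 2 = q%:R + 2 + (p%:R + 1) - 2 * (U * V).
  by rewrite -UU -VV; ring.
move: gap2 UV; rewrite UV2; lra.
Qed.

End spectral_edge_constants.

Section smallest_singular_value.
Context {R : realType} d (T : measurableType d) (P : probability T R).

Lemma probability_split (S E : set T) : measurable S -> measurable E ->
  (P S <= P E + P (S `&` ~` E))%E.
Proof.
move=> mS mE; have mSE : measurable (S `&` ~` E).
  by apply: measurableI => //; exact: measurableC.
apply: le_trans (measureU2 P mE mSE).
apply: le_measure; rewrite ?inE//; first exact: measurableU.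
by move=> w Sw; have [Ew|nEw] := pselect (E w); [left|right].
Qed.

Lemma measurable_sqn_gt m n (X : T -> 'M[R]_(m, n)) (c t : R) :
  (forall i j, measurable_fun setT (fun w => X w i j)) ->
  measurable [set w | t < `|sqn (X w) - c|].
Proof.
move=> mX.
have mZ : measurable_fun setT (fun w => `|sqn (X w) - c|).
  apply: measurableT_comp => //; apply: measurable_funB => //.
  exact: measurable_sqn.
have := mZ measurableT _ (measurable_itv `]t, +oo[); rewrite setTI.
by congr measurable; apply/seteqP; split=> w /=; rewrite in_itv/= andbT.
Qed.

Lemma gauss_matrix_measurable m n (X : T -> 'M[R]_(m, n)) :
  gauss_matrix P X -> forall i j, measurable_fun setT (fun w => X w i j).
Proof. by move=> [mX _] i j; exact: (mX (i, j)). Qed.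

(** The bound of [chi_square_tail] for [t = e^2]: squared norms deviating by [e^2 n] correspond to
    norms deviating by at most [e sqrt n]. *)
Definition chi_tail (n : nat) (e : R) : R := 2 * expR (- ((e ^+ 2) ^+ 2 * n%:R / 16)).

Lemma gauss_row_tail k n (X : T -> 'rV[R]_k) (e : R) : (k <= n)%N -> 0 < e <= 1 ->
  gauss_matrix P X ->
  (P [set w | (e ^+ 2 * n%:R < `|sqn (X w) - k%:R|)%R] <= (chi_tail n e)%:E)%E.
Proof.
move=> kn /andP[e0 e1] gX.
have cI : #|{: 'I_1 * 'I_k}| = k by rewrite card_prod !card_ord mul1n.
have e2 : 0 < e ^+ 2 <= 1 by rewrite exprn_gt0//= exprn_ile1// ltW.
have := chi_square_tail (I := ('I_1 * 'I_k)%type) (n := n) _ e2 gX; rewrite cI => /(_ kn).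
congr (P _ <= _)%E; apply/funext => w /=; congr (_ < `|_ - _|).
by rewrite /sqn pair_bigA.
Qed.

Lemma rotation_axis n (v : 'rV[R]_n) : exists H : 'M[R]_n, rotation P H /\
  forall j : 'I_n, (0 < j)%N -> (v *m H) 0 j = 0.
Proof.
case: n v => [|n] v; first by exists 1%:M; split=> [|[]//]; exact: rotation1.
by have [H [rH vH _]] := rotation_row P v 0; exists H.
Qed.

End smallest_singular_value.

Section smallest_singular_value_tail.
Context {R : realType} d (T : measurableType d) (P : probability T R).

Lemma gauss_matrix_trmulmx p q (X : T -> 'M[R]_(p, q)) (K : 'M[R]_p) :
  rotation P K -> gauss_matrix P X -> gauss_matrix P (fun w => K^T *m X w).
Proof.
move=> [_ gK] gX; have := gauss_matrix_tr (gK _ _ (gauss_matrix_tr gX)).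
by under eq_fun do rewrite trmx_mul trmxK.
Qed.

Lemma measurable_col_mx m n p d' (T' : measurableType d')
    (X : T' -> 'M[R]_(m, n)) (Y : T' -> 'M[R]_(p, n)) :
  (forall i j, measurable_fun setT (fun w => X w i j)) ->
  (forall i j, measurable_fun setT (fun w => Y w i j)) ->
  forall i j, measurable_fun setT (fun w => col_mx (X w) (Y w) i j).
Proof.
move=> mX mY i j; case: (split_ordP i) => k ->.
  under eq_fun do rewrite col_mxEu; exact: mX.
under eq_fun do rewrite col_mxEd; exact: mY.
Qed.

(** Second half of a step, the first row being already [(r, 0, .., 0)]. Either the rest of the first
    column has an atypical norm, at cost [chi_tail n e], or it is frozen and a rotation chosen from
    it alone keeps the remaining block Gaussian, so that the bound [k] for that block applies. *)
Lemma small_form_first_column n m (e k r : R) p q (A : T -> 'M[R]_(p, 1 + q)) :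
  0 < e <= 1 -> (p.+1 <= m)%N -> (m <= n)%N -> (q + m = p + n)%N -> 0 <= k ->
  (forall B : T -> 'M[R]_(p, q), gauss_matrix P B ->
    (P [set w | small_form (edge_level n m e) (head_weight n e p q) (B w)]
      <= k%:E)%E) ->
  `|r ^+ 2 - q.+1%:R| <= e ^+ 2 * n%:R -> gauss_matrix P A ->
  (P [set w | small_form (edge_level n m e) (head_weight n e p.+1 q.+1)
     (col_mx (row_mx r%:M 0) (A w) : 'M[R]_(1 + p, 1 + q))]
    <= (chi_tail n e + k)%:E)%E.
Proof.
move=> e01 pm mn qmpn k0 IH rq gA; have mA := gauss_matrix_measurable gA.
have /andP[e0 e1] := e01.
pose S := [set A : 'M[R]_(p, 1 + q) | small_form (edge_level n m e)
  (head_weight n e p.+1 q.+1) (col_mx (row_mx r%:M 0) A : 'M[R]_(1 + p, 1 + q))].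
pose E := [set A : 'M[R]_(p, 1 + q) | e ^+ 2 * n%:R < `|sqn (lsubmx A) - p%:R|].
have bS : borel_matrix_set S.
  by move=> d' T' X mX; apply: borel_small_form; exact: measurable_col_mx.
have bE : borel_matrix_set E.
  move=> d' T' X mX; apply: measurable_sqn_gt => i j.
  under eq_fun do rewrite mxE; exact: mX.
have mS : measurable [set w | S (A w)] by exact: bS.
have mE : measurable [set w | E (A w)] by exact: bE.
apply: (le_trans (probability_split P mS mE)); rewrite EFinD; apply: leeD.
  have gl : gauss_matrix P (fun w => (lsubmx (A w))^T).
    apply: gauss_matrix_tr.
    have := gauss_matrix_mxsub (@inj_id 'I_p) (@lshift_inj 1 q) gA.
    by congr (gauss_matrix P _); apply/funext => w; apply/matrixP => i j; rewrite !mxE.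
  have pn : (p <= n)%N by lia.
  have := gauss_row_tail pn e01 gl; congr (P _ <= _)%E.
  by apply/funext => w; rewrite /E /= sqn_tr.
apply: (gauss_matrix_split_le (J := fun i j => (j < 1)%N)
    (S := S `&` ~` E) gA) => [||w] //.
  move=> d' T' X mX; apply: measurableI; first exact: bS.
  by apply: measurableC; exact: bE.
pose mixm w' : 'M[R]_(p, 1 + q) :=
  \matrix_(i, j) if (j < 1)%N then A w i j else A w' i j.
rewrite -[mkset _]/[set w' | (S `&` ~` E) (mixm w')].
have mixE w' : mixm w' = row_mx (lsubmx (A w)) (rsubmx (A w')).
  by apply/matrixP => i j; rewrite !mxE; case: (split_ordP j) => l ->; rewrite !mxE.
have [Ew|nEw] := pselect (E (A w)).
  rewrite (_ : mkset _ = set0) ?measure0 ?lee_fin// predeqE => w'; split=> // -[_].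
  by rewrite mixE /E /= row_mxKl => /(_ Ew).
have [K [rK vK]] := rotation_axis P (lsubmx (A w))^T.
have [K1 _] := rK.
pose B w' := K^T *m rsubmx (A w').
have gB : gauss_matrix P B.
  apply: gauss_matrix_trmulmx => //.
  have := gauss_matrix_mxsub (@inj_id 'I_p) (@rshift_inj 1 q) gA.
  by congr (gauss_matrix P _); apply/funext => w'; apply/matrixP => i j; rewrite !mxE.
apply: le_trans (IH _ gB); apply: le_measure; rewrite ?inE.
- have mmix i j : measurable_fun setT (fun w' => mixm w' i j).
    under eq_fun do rewrite mxE; case: (j < 1)%N; [exact: measurable_cst|exact: mA].
  apply: measurableI; first exact: bS.
  by apply: measurableC; exact: bE.
- by apply: borel_small_form; exact: (gauss_matrix_measurable gB).
move=> w' [Sw' _]; move: Sw'; rewrite /S /= mixE.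
have a2 : Num.sqrt (r ^+ 2) ^+ 2 = r ^+ 2 by rewrite sqr_sqrtr// sqr_ge0.
set v := lsubmx (A w).
have b2 : Num.sqrt (sqn v) ^+ 2 = sqn v by rewrite sqr_sqrtr// sqn_ge0.
have an : `|Num.sqrt (r ^+ 2) ^+ 2 - q.+1%:R| <= e ^+ 2 * n%:R by rewrite a2.
have bn : `|Num.sqrt (sqn v) ^+ 2 - p%:R| <= e ^+ 2 * n%:R.
  by rewrite b2 leNgt; apply/negP => h; apply: nEw.
have e01' : 0 <= e <= 1 by rewrite ltW.
have qn : 0 <= (q.+1%:R : R) <= n%:R by rewrite ler0n ler_nat; lia.
have pn : 0 <= (p%:R : R) <= n%:R.
  by rewrite ler0n ler_nat (leq_trans (ltnW pm)).
have ab := le_mul_sqrt_add (sqrtr_ge0 _) (sqrtr_ge0 _) e01' qn pn an bn.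
have een := sqr_near_le1 n e01'.
(* The product [a b] costs [3 e n] and each square at most [e^2 n <= e n]: together the [4 e n]
   provided by [head_weight] and [edge_level_step]. *)
apply: (small_form_step K1 vK (sqrtr_ge0 (r ^+ 2)) (sqrtr_ge0 (sqn v))) => //.
  rewrite /head_weight; move: bn; rewrite ler_norml => /andP[]; move: ab een; lra.
have := @edge_level_step R n m e p q pm mn qmpn.
move: an; rewrite ler_norml => /andP[]; move: ab een; lra.
Qed.

(** Induction on the number of rows. Each step pays one [chi_tail] for its row and one for its
    column, and removing both preserves [q + m = p + n]. *)
Lemma small_form_tail n m (e : R) : 0 < e <= 1 -> (m <= n)%N ->
  forall p q (G : T -> 'M[R]_(p, q)), (p <= m)%N -> (q + m = p + n)%N ->
    gauss_matrix P G ->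
    (P [set w | small_form (edge_level n m e) (head_weight n e p q) (G w)] <=
     (2 * p%:R * chi_tail n e)%:E)%E.
Proof.
move=> e01 mn.
have chi0 : 0 <= chi_tail n e by rewrite mulr_ge0// expR_ge0.
elim=> [|p IHp] q G pm qmpn gG.
  rewrite (_ : mkset _ = set0) ?measure0 ?mulr0 ?mul0r// predeqE => w; split=> // -[x].
  rewrite thinmx0 mul0mx /head_sqr big_ord0 mulr0 addr0 !sqn_mxtrace !mul0mx.
  by rewrite !mxtrace0 mulr0 ltxx.
case: q G qmpn gG => [|q] G qmpn gG; first by exfalso; lia.
pose S := [set A : 'M[R]_(1 + p, 1 + q) | small_form (edge_level n m e)
  (head_weight n e p.+1 q.+1) A].
pose E := [set A : 'M[R]_(1 + p, 1 + q) | e ^+ 2 * n%:R < `|sqn (usubmx A) - q.+1%:R|].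
have mG := gauss_matrix_measurable gG.
have bS : borel_matrix_set S by exact: borel_small_form.
have bE : borel_matrix_set E.
  move=> d' T' X mX; apply: measurable_sqn_gt => i j.
  under eq_fun do rewrite mxE; exact: mX.
have mS : measurable [set w | S (G w)] by exact: bS.
have mE : measurable [set w | E (G w)] by exact: bE.
apply: (le_trans (probability_split P mS mE)).
have -> : 2 * p.+1%:R * chi_tail n e =
    chi_tail n e + (chi_tail n e + 2 * p%:R * chi_tail n e).
  by rewrite -natr1; ring.
rewrite [leRHS]EFinD; apply: leeD.
  have gu : gauss_matrix P (fun w => usubmx (G w : 'M[R]_(1 + p, 1 + q))).
    have := gauss_matrix_mxsub (@lshift_inj 1 p) (@inj_id 'I_q.+1) gG.
    by congr (gauss_matrix P _); apply/funext => w; apply/matrixP => i j; rewrite !mxE.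
  have qn : (q.+1 <= n)%N by lia.
  exact: gauss_row_tail qn e01 gu.
(* The first row is frozen; the rotation [H] that aligns it with the first axis is then constant and
   keeps the rows below Gaussian. *)
apply: (gauss_matrix_split_le (J := fun (i : 'I_(1 + p)) (j : 'I_(1 + q)) => (i < 1)%N)
    (S := S `&` ~` E) gG) => [||w] //.
- move=> d' T' X mX; apply: measurableI; first exact: bS.
  by apply: measurableC; exact: bE.
- by rewrite addr_ge0// !mulr_ge0.
pose mixm w' : 'M[R]_(1 + p, 1 + q) :=
  \matrix_(i, j) if (i < 1)%N then G w i j else G w' i j.
rewrite -[mkset _]/[set w' | (S `&` ~` E) (mixm w')].
pose D w := dsubmx (G w : 'M[R]_(1 + p, 1 + q)).
pose U w := usubmx (G w : 'M[R]_(1 + p, 1 + q)).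
have mixE w' : mixm w' = col_mx (U w) (D w').
  by apply/matrixP => i j; rewrite !mxE; case: (split_ordP i) => l ->; rewrite !mxE.
have [Ew|nEw] := pselect (E (G w)).
  rewrite (_ : mkset _ = set0) ?measure0.
    by rewrite lee_fin addr_ge0// !mulr_ge0.
  rewrite predeqE => w'; split=> // -[_].
  by rewrite mixE /E /= col_mxKu => /(_ Ew).
have [H [rH vH]] := rotation_axis P (U w).
have [H1 gH] := rH.
have gD : gauss_matrix P (fun w => D w *m H).
  apply: gH; have := gauss_matrix_mxsub (@rshift_inj 1 p) (@inj_id 'I_q.+1) gG.
  by congr (gauss_matrix P _); apply/funext => w'; apply/matrixP => i j; rewrite !mxE.
pose r := (U w *m H) 0 0.
have UH : U w *m H = row_mx (r%:M : 'M[R]_1) 0.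
  apply/rowP => j; case: (split_ordP j) => l ->; rewrite ?row_mxEl ?row_mxEr.
    by rewrite [RHS]mxE !ord1 eqxx mulr1n /r; congr (_ 0 _); exact: val_inj.
  by rewrite [RHS]mxE vH.
have rU : r ^+ 2 = sqn (U w).
  rewrite -(sqn_orthogonal (U w) H1) UH sqn_row_mx sqn_scalar.
  by rewrite sqn_mxtrace mul0mx mxtrace0 addr0.
have qn : (q + m = p + n)%N by lia.
have k0 : 0 <= 2 * p%:R * chi_tail n e by rewrite !mulr_ge0.
have rq : `|r ^+ 2 - q.+1%:R| <= e ^+ 2 * n%:R.
  by rewrite rU leNgt; apply/negP => h; apply: nEw.
have := small_form_first_column e01 pm mn qn k0
  (fun B gB => IHp q B (ltnW pm) qn gB) rq gD.
apply: le_trans; apply: le_measure; rewrite ?inE.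
- have mmix i j : measurable_fun setT (fun w' => mixm w' i j).
    under eq_fun do rewrite mxE; case: (i < 1)%N; [exact: measurable_cst|exact: mG].
  apply: measurableI; first exact: bS.
  by apply: measurableC; exact: bE.
- apply: borel_small_form.
  by apply: measurable_col_mx => [i j|]; [exact: measurable_cst|exact: (gauss_matrix_measurable gD)].
move=> w' [Sw' _]; move: Sw'; rewrite /S /= mixE => -[x xlt]; exists x.
by rewrite -UH -mul_col_mx mulmxA (sqn_orthogonal _ H1).
Qed.

End smallest_singular_value_tail.

(** * Distances from the rows to the span of the others *)

Section row_distances.
Context {R : realType}.

Lemma continuous_csub (V : topologicalType) (f : V -> R) (c : R) :
  continuous f -> continuous (fun x => c - f x).
Proof. by move=> cf x; apply: cvgB; [exact: cvg_cst|exact: cf]. Qed.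

Lemma continuous_subc (V : topologicalType) (f : V -> R) (c : R) :
  continuous f -> continuous (fun x => f x - c).
Proof. by move=> cf x; apply: cvgB; [exact: cf|exact: cvg_cst]. Qed.

(** The squared distance from row [i] to the span of the other rows is below [t]. The strict
    existential form makes the event measurable by [measurable_exists_lt0]. *)
Definition near_row m n (i : 'I_m) (t : R) (G : 'M[R]_(m, n)) : Prop :=
  exists x : 'rV_m.-1, sqn (row i G - x *m row' i G) < t.

Lemma borel_near_row m n (i : 'I_m) (t : R) :
  borel_matrix_set (@near_row m n i t).
Proof.
move=> d T X mX.
pose Q (x : 'rV[R]_m.-1) w := sqn (row i (X w) - x *m row' i (X w)) - t.
rewrite (_ : mkset _ = [set w | exists x, Q x w < 0]).
  apply: measurable_exists_lt0 => [x|w].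
    apply: measurable_funB => //; apply: measurable_sqn => j l.
    under eq_fun do rewrite mxE mxE mxE; apply: measurable_funB => //.
    by apply: measurable_mulmxl => a b; under eq_fun do rewrite mxE; exact: mX.
  have c1 : continuous (fun x : 'rV[R]_m.-1 => sqn (row i (X w) - x *m row' i (X w))).
    apply: continuous_sqn => j l; under eq_fun do rewrite mxE mxE mxE.
    by apply: continuous_csub; exact: continuous_mulmxr.
  exact: continuous_subc.
by rewrite predeqE => w; split=> -[x]; rewrite /Q ?subr_lt0 => Qx; exists x;
  rewrite ?subr_lt0.
Qed.

(* The lower bound on [row' i G] makes its rows free; were they dependent, the
   squared distance would have more degrees of freedom. *)
Definition atypical_row m n (i : 'I_m) (L t u : R) (G : 'M[R]_(m, n)) : Prop :=
  near_row i t G \/ (~ near_row i u G /\ ~ small_form L 0 (row' i G)).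

Lemma borel_atypical_row m n (i : 'I_m) (L t u : R) :
  borel_matrix_set (@atypical_row m n i L t u).
Proof.
move=> d T X mX; apply: measurableU; first exact: borel_near_row.
apply: measurableI; apply: measurableC; first exact: borel_near_row.
apply: (@borel_small_form _ _ _ L 0 _ _ (fun w => row' i (X w))) => a b.
under eq_fun do rewrite mxE; exact: mX.
Qed.

Lemma not_small_form_unitmx k (L : R) (B : 'M[R]_k) : 0 < L ->
  ~ small_form L 0 B -> B \in unitmx.
Proof.
move=> L0 nB; rewrite -row_free_unit -kermx_eq0; apply/rowV0P => v.
move=> /sub_kermxP vB; apply/sqn_eq0/eqP; rewrite eq_le sqn_ge0 andbT leNgt.
apply/negP => v0; apply: nB; exists v.
by rewrite vB sqn_mxtrace mul0mx mxtrace0 mul0r addr0 mulr_gt0.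
Qed.

(** After the rotation the rows of [A] live in the first [k] coordinates, so no combination of them
    affects the last [N] coordinates of [g]. When the square block [B] is invertible the first [k]
    can be cancelled, and the residual is the exact distance. *)
Lemma atypical_row_residual k N (L t u : R) (g : 'rV[R]_(k + N))
    (A : 'M[R]_(k, k + N)) (H : 'M[R]_(k + N)) : 0 < L ->
  H *m H^T = 1%:M ->
  (forall i (j : 'I_(k + N)), (k <= j)%N -> (A *m H) i j = 0) ->
  ((exists x, sqn (g - x *m A) < t) -> sqn (rsubmx (g *m H)) < t) /\
  (~ (exists x, sqn (g - x *m A) < u) -> ~ small_form L 0 A ->
   u <= sqn (rsubmx (g *m H))).
Proof.
move=> L0 H1 AH0; set B := lsubmx (A *m H); set g1 := lsubmx (g *m H).
have AH : A *m H = row_mx B 0.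
  rewrite -[A *m H]hsubmxK; congr row_mx; apply/matrixP => i j.
  by rewrite !mxE; have := AH0 i (rshift k j) (leq_addr _ _); rewrite mxE.
have resE x : sqn (g - x *m A) = sqn (g1 - x *m B) + sqn (rsubmx (g *m H)).
  rewrite -(sqn_orthogonal _ H1) mulmxBl -mulmxA AH mul_mx_row mulmx0.
  rewrite -[g *m H]hsubmxK opp_row_mx add_row_mx oppr0 addr0 sqn_row_mx.
  by rewrite row_mxKr.
split=> [[x]|ng nA].
  by rewrite resE; apply: le_lt_trans; rewrite lerDr sqn_ge0.
have uB : B \in unitmx.
  apply: (not_small_form_unitmx L0) => -[x xB]; apply: nA; exists x.
  by rewrite -(sqn_orthogonal _ H1) -mulmxA AH mul_mx_row mulmx0 sqn_row_mx
    [sqn 0]sqn_mxtrace mul0mx mxtrace0 addr0.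
rewrite leNgt; apply/negP => lt_u; apply: ng; exists (g1 *m invmx B).
by rewrite resE mulmxKV// subrr [sqn 0]sqn_mxtrace mul0mx mxtrace0 add0r.
Qed.

Context d (T : measurableType d) (P : probability T R).

Lemma atypical_row_tail k N (e L : R) (i : 'I_k.+1)
    (G : T -> 'M[R]_(k.+1, k + N)) :
  0 < e <= 1 -> 0 < L -> (0 < k + N)%N -> gauss_matrix P G ->
  (P [set w | atypical_row i L (N%:R - e ^+ 2 * (k + N)%:R)
      (N%:R + 2 * (e ^+ 2 * (k + N)%:R)) (G w)] <= (chi_tail (k + N) e)%:E)%E.
Proof.
move=> e01 L0 kN gG; have mG := gauss_matrix_measurable gG.
set t := N%:R - _; set u := N%:R + _.
have chi0 : 0 <= chi_tail (k + N) e by rewrite mulr_ge0// expR_ge0.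
apply: (gauss_matrix_split_le (J := fun r c => r != i)
  (S := @atypical_row k.+1 (k + N) i L t u) gG) => [||w] //.
  exact: borel_atypical_row.
pose mixm w' : 'M[R]_(k.+1, k + N) :=
  \matrix_(r, c) if r != i then G w r c else G w' r c.
rewrite -[mkset _]/[set w' | atypical_row i L t u (mixm w')].
have mix1 w' : row i (mixm w') = row i (G w').
  by apply/rowP => j; rewrite !mxE eqxx.
have mix2 w' : row' i (mixm w') = row' i (G w).
  by apply/matrixP => r c; rewrite !mxE eq_sym neq_lift.
have [H [[H1 gH] AH]] := rotation_triangular P (row' i (G w)) (leq_addr N k).
have grow : gauss_matrix P (fun w' => row i (G w')).
  have cI : injective (fun _ : 'I_1 => i) by move=> a b _; rewrite !ord1.
  have := gauss_matrix_mxsub cI (@inj_id 'I_(k + N)) gG.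
  by congr (gauss_matrix P _); apply/funext => w'; apply/matrixP => a b; rewrite !mxE.
have gres : gauss_matrix P (fun w' => rsubmx (row i (G w') *m H)).
  have := gauss_matrix_mxsub (@inj_id 'I_1) (@rshift_inj k N) (gH _ _ grow).
  by congr (gauss_matrix P _); apply/funext => w'; apply/matrixP => a b; rewrite !mxE.
have := gauss_row_tail (leq_addl k N) e01 gres.
apply: le_trans; apply: le_measure; rewrite ?inE.
- apply: borel_atypical_row => a b; under eq_fun do rewrite mxE.
  by case: (a != i); [exact: measurable_cst|exact: mG].
- by apply: measurable_sqn_gt; exact: (gauss_matrix_measurable gres).
have /andP[e0 _] := e01.
(* The upper threshold [u] has twice the deviation, so that the non-strict [u <= s] still gives a
   strict deviation. *)
have d0 : 0 < e ^+ 2 * (k + N)%:R by rewrite mulr_gt0 ?exprn_gt0// ltr0n.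
move=> w' /=; rewrite /atypical_row /near_row mix1 mix2.
have [h1 h2] := atypical_row_residual t u (row i (G w')) L0 H1 AH.
case=> [/h1|[/h2 h3 /h3]]; set s := sqn _ => sb.
  by rewrite ltr_normr; apply/orP; right; move: sb; rewrite /t; lra.
by rewrite ltr_normr; apply/orP; left; move: sb d0; rewrite /u; lra.
Qed.

End row_distances.

(** * The pseudo-inverse *)

Section pseudo_inverse.
Context {R : realType}.

Lemma cauchy_schwarz n (v : 'rV[R]_n) (u : 'cV[R]_n) :
  ((v *m u) 0 0) ^+ 2 <= sqn v * sqn u.
Proof.
have [u0|u0] := eqVneq (sqn u) 0.
  by rewrite (sqn_eq0 u0) mulmx0 mxE expr0n mulr_ge0 ?sqn_ge0.
have su : 0 < sqn u by rewrite lt0r u0 sqn_ge0.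
set b := (v *m u) 0 0.
have E t : \sum_j (v 0 j - t * u j 0) ^+ 2 = sqn v - 2 * t * b + t ^+ 2 * sqn u.
  have -> : sqn v = \sum_j v 0 j ^+ 2 by rewrite /sqn big_ord1.
  have -> : sqn u = \sum_j u j 0 ^+ 2.
    by apply: eq_bigr => j _; rewrite big_ord1.
  rewrite /b mxE !mulr_sumr -sumrB -big_split/=; apply: eq_bigr => j _; ring.
(* The polynomial [E t] is taken at its minimum [t = b / sqn u]. *)
have : 0 <= sqn u * (sqn v - 2 * (b / sqn u) * b + (b / sqn u) ^+ 2 * sqn u).
  by rewrite -E mulr_ge0 ?sqn_ge0// sumr_ge0// => j _; exact: sqr_ge0.
suff -> : sqn u * (sqn v - 2 * (b / sqn u) * b + (b / sqn u) ^+ 2 * sqn u) =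
  sqn v * sqn u - b ^+ 2 by rewrite subr_ge0.
by field.
Qed.

Lemma mulmx_row_row' m n p (i : 'I_m) (A : 'M[R]_(m, p)) (G : 'M[R]_(m, n)) :
  A^T *m G = (row i A)^T *m row i G + (row' i A)^T *m row' i G.
Proof.
case: m i A G => [[]//|m] i A G; apply/matrixP => a b.
rewrite mxE (bigD1_ord i)//= mxE !mxE big_ord1 !mxE; congr (_ + _).
by apply: eq_bigr => k _; rewrite !mxE.
Qed.

Lemma sqnZ m n (a : R) (A : 'M[R]_(m, n)) : sqn (a *: A) = a ^+ 2 * sqn A.
Proof.
rewrite /sqn mulr_sumr; apply: eq_bigr => i _; rewrite mulr_sumr.
by apply: eq_bigr => j _; rewrite mxE exprMn.
Qed.

Section full_row_rank.
Variables (m n : nat) (G : 'M[R]_(m, n)) (L : R).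
Hypotheses (L0 : 0 < L) (GL : forall x : 'rV_m, L * sqn x <= sqn (x *m G)).

Let W := invmx (G *m G^T).

Let uG : G *m G^T \in unitmx.
Proof.
apply: gram_unitmx; rewrite -kermx_eq0; apply/rowV0P => v.
move=> /sub_kermxP vG; apply/sqn_eq0/eqP; rewrite eq_le sqn_ge0 andbT.
have := GL v; rewrite vG [sqn 0]sqn_mxtrace mul0mx mxtrace0.
by rewrite pmulr_rle0.
Qed.

Let WT : W^T = W. Proof. by rewrite trmx_inv trmx_mul trmxK. Qed.

Lemma mpinvE : mpinv G = G^T *m W.
Proof.
apply/esym/mpinvP.
have GX : G *m (G^T *m W) = 1%:M by rewrite mulmxA mulmxV.
split; rewrite ?GX ?mul1mx ?trmx1//.
  by rewrite -mulmxA GX mulmx1.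
by rewrite !trmx_mul trmxK WT mulmxA.
Qed.

Lemma mulmx_mpinv : G *m mpinv G = 1%:M.
Proof. by rewrite mpinvE mulmxA mulmxV. Qed.

Lemma gram_mpinv : (mpinv G)^T *m mpinv G = W.
Proof.
by rewrite mpinvE trmx_mul trmxK WT mulmxA -(mulmxA W) mulVmx// mul1mx.
Qed.

(** For [x = (W y)^T] the number [q = |mpinv G y|^2] equals both [|x G|^2] and [x y]. Hence
    [L q^2 <= L |x|^2 <= q] when [|y| <= 1], and so [q <= 1 / L]. *)
Lemma spectral_norm_mpinv : spectral_norm (mpinv G) <= (Num.sqrt L)^-1.
Proof.
have [S0 _] := spectral_norm_has_sup (mpinv G).
apply: sup_le_ub => // _ [y /= y1 <-].
have y1' : sqn y <= 1.
  by move: y1; rewrite /frobenius_norm -/(sqn y) -{1}sqrtr1 ler_sqrt.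
rewrite /frobenius_norm -/(sqn (mpinv G *m y)) -sqrtrV ?(ltW L0)//.
apply: ler_wsqrtr; set q := sqn _.
have q0 : 0 <= q by exact: sqn_ge0.
pose x := (W *m y)^T.
have qE : q = sqn (x *m G).
  by rewrite /q mpinvE -mulmxA -sqn_tr trmx_mul trmxK.
have qxy : q = (x *m y) 0 0.
  have -> : q = \tr (x *m G *m (x *m G)^T) by rewrite qE sqn_mxtrace.
  rewrite trmx_mul [x^T]trmxK.
  have -> : x *m G *m (G^T *m (W *m y)) = x *m (G *m G^T *m W *m y).
    by rewrite !mulmxA.
  by rewrite mulmxV// mul1mx /mxtrace big_ord1.
have := cauchy_schwarz x y; rewrite -qxy => q2.
have := GL x; rewrite -qE => Lx.
have [-> |qN0] := eqVneq q 0; first by rewrite invr_ge0 ltW.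
have q_gt0 : 0 < q by rewrite lt0r qN0.
rewrite -(ler_pM2l L0) mulfV ?gt_eqF// -(ler_pM2r q_gt0) mul1r.
apply: le_trans Lx; rewrite -mulrA ler_pM2l// -expr2.
by apply: (le_trans q2); rewrite ler_piMr// sqn_ge0.
Qed.

Section columns.
Variable i : 'I_m.
Let s := sqn (col i (mpinv G)).

Let sW : s = W i i.
Proof.
rewrite -gram_mpinv mxE /s /sqn; apply: eq_bigr => j _.
by rewrite big_ord1 !mxE expr2.
Qed.

(** As [G *m mpinv G] is the identity, column [i] of the pseudo-inverse has product 1 with row [i]
    and 0 with the others. *)
Let residual_mul (x : 'rV[R]_m.-1) :
  ((row i G - x *m row' i G) *m col i (mpinv G)) 0 0 = 1.
Proof.
have GX (A : 'M[R]_(1, m)) : A *m G *m col i (mpinv G) = col i A.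
  by rewrite !colE mulmxA -(mulmxA A) mulmx_mpinv mulmx1.
have rE : row i G = row i 1%:M *m G by rewrite -row_mul mul1mx.
have r'E : row' i G = row' i 1%:M *m G by rewrite !row'Esub mul_rowsub_mx mul1mx.
rewrite rE r'E mulmxA -mulmxBl GX !mxE eqxx big1 ?subr0// => j _.
by rewrite !mxE eq_sym (negbTE (neq_lift _ _)) mulr0.
Qed.

Lemma col_mpinv_gt0 : 0 < s.
Proof.
rewrite lt0r sqn_ge0 andbT; apply/eqP => /sqn_eq0 X0.
have := residual_mul 0; rewrite X0 mulmx0 mxE => /eqP.
by rewrite eq_sym oner_eq0.
Qed.

Lemma near_row_mpinv (t : R) : 0 < t -> near_row i t G -> t^-1 <= s.
Proof.
move=> t0 [x xt]; have := cauchy_schwarz (row i G - x *m row' i G) (col i (mpinv G)).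
rewrite residual_mul expr1n => h.
rewrite -(ler_pM2l t0) mulfV ?gt_eqF//; apply: (le_trans h).
by rewrite ler_wpM2r ?sqn_ge0// ltW.
Qed.

(** Column [i] of the pseudo-inverse combines the rows of [G] with coefficients from column [i] of
    [W], and that of row [i] is [W i i = s]. Divided by [s], it is a residual of row [i] with
    squared norm [1 / s]. *)
Lemma not_near_row_mpinv (t : R) : 0 < t -> ~ near_row i t G -> s <= t^-1.
Proof.
move=> t0 nt; have s0 := col_mpinv_gt0.
pose x : 'rV[R]_m.-1 := - (s^-1 *: (row' i (col i W))^T).
have vE : row i G - x *m row' i G = s^-1 *: (col i (mpinv G))^T.
  have := mulmx_row_row' i (col i W) G.
  have -> : (col i W)^T *m G = (col i (mpinv G))^T.
    by rewrite mpinvE !colE -mulmxA [RHS]trmx_mul trmxK.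
  have -> : (row i (col i W))^T *m row i G = s *: row i G.
    by rewrite [row i _]mx11_scalar tr_scalar_mx mul_scalar_mx !mxE sW.
  move=> ->; rewrite scalerDr scalerA mulVf ?gt_eqF// scale1r; congr (_ + _).
  by rewrite /x mulNmx -scalemxAl opprK.
rewrite leNgt; apply/negP => st; apply: nt; exists x.
rewrite vE sqnZ sqn_tr -/s expr2 -mulrA mulVf ?gt_eqF// mulr1.
by rewrite -[ltRHS]invrK ltf_pV2 ?posrE ?invr_gt0.
Qed.

End columns.
End full_row_rank.
End pseudo_inverse.

Section typical_matrix.
Context {R : realType} (m n : nat) (G : 'M[R]_(m, n)) (L : R).

Lemma not_small_formP c : 0 <= c -> ~ small_form L c G ->
  forall x : 'rV_m, L * sqn x <= sqn (x *m G).
Proof.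
move=> c0 nG x; rewrite leNgt; apply/negP => lt1; apply: nG; exists x.
by rewrite ltr_wpDr// mulr_ge0// head_sqr_ge0.
Qed.

(** Removing a row cannot lower the smallest singular value: [x *m row' i 1%:M] is [x] padded with a
    zero at [i]. *)
Lemma not_small_form_row' (i : 'I_m) :
  (forall x : 'rV_m, L * sqn x <= sqn (x *m G)) -> ~ small_form L 0 (row' i G).
Proof.
move=> GL [x]; rewrite mul0r addr0 ltNge => /negP; apply.
have H1 : row' i (1%:M : 'M[R]_m) *m (row' i 1%:M)^T = 1%:M.
  rewrite row'Esub mul_rowsub_mx mul1mx; apply/matrixP => a b; rewrite !mxE.
  by rewrite eq_sym (inj_eq lift_inj).
rewrite -(sqn_orthogonal x H1) (_ : x *m row' i G = x *m row' i 1%:M *m G)//.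
by rewrite -mulmxA !row'Esub mul_rowsub_mx mul1mx.
Qed.

Lemma mpinv_bounds c lo up : 0 < L -> 0 <= c -> 0 < lo -> 0 < up ->
  ~ small_form L c G -> (forall i, ~ atypical_row i L lo up G) ->
  [/\ m%:R / up <= sqn (mpinv G), sqn (mpinv G) <= m%:R / lo &
      spectral_norm (mpinv G) <= (Num.sqrt L)^-1].
Proof.
move=> L0 c0 lo0 up0 nG typ; have GL := not_small_formP c0 nG.
have sqn_cols : sqn (mpinv G) = \sum_(i < m) sqn (col i (mpinv G)).
  rewrite /sqn exchange_big/=; apply: eq_bigr => i _; apply: eq_bigr => j _.
  by rewrite big_ord1 mxE.
have sum_cst (a : R) : m%:R * a = \sum_(i < m) a.
  by rewrite sumr_const card_ord mulr_natl.
split; last exact: spectral_norm_mpinv.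
- rewrite sqn_cols sum_cst; apply: ler_sum => i _.
  apply: (near_row_mpinv L0 GL) => //.
  apply: contrapT => ni; apply: (typ i); right; split => //.
  exact: not_small_form_row'.
- rewrite sqn_cols sum_cst; apply: ler_sum => i _.
  apply: (not_near_row_mpinv L0 GL) => // ni.
  by apply: (typ i); left.
Qed.

End typical_matrix.

(** * Almost sure limits *)

Section atypical_matrices.
Context {R : realType}.

(* For small [n] the level may be negative, and then nothing is asked. *)
Definition atypical m n (e : R) (G : 'M[R]_(m, n)) : Prop :=
  0 < edge_level n m e /\
  (small_form (edge_level n m e) (head_weight n e m n) G \/
   exists i, atypical_row i (edge_level n m e)
     ((n - m).+1%:R - e ^+ 2 * n%:R)
     ((n - m).+1%:R + 2 * (e ^+ 2 * n%:R)) G).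

Context d (T : measurableType d) (P : probability T R).

Lemma measure_bigsetU_le (I : Type) (r : seq I) (A : I -> set T) :
  (forall i, measurable (A i)) ->
  (P (\big[setU/set0]_(i <- r) A i) <= \sum_(i <- r) P (A i))%E.
Proof.
move=> mA; elim: r => [|i r IHr]; first by rewrite !big_nil measure0.
rewrite !big_cons; apply: (le_trans (measureU2 P (mA i) _)).
  exact: bigsetU_measurable.
exact: leeD.
Qed.

Lemma atypical_row_tail_le m n (e L : R) (i : 'I_m) (G : T -> 'M[R]_(m, n)) :
  0 < e <= 1 -> 0 < L -> (m <= n)%N -> gauss_matrix P G ->
  (P [set w | atypical_row i L ((n - m).+1%:R - e ^+ 2 * n%:R)
      ((n - m).+1%:R + 2 * (e ^+ 2 * n%:R)) (G w)] <= (chi_tail n e)%:E)%E.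
Proof.
case: m i G => [[]//|k] i G e01 L0 kn gG.
(* The other [k = m - 1] rows leave [n - m + 1] residual coordinates. *)
have nE : n = (k + (n - k.+1).+1)%N by lia.
move: (n - k.+1)%N nE G gG {kn} => N -> G gG.
by apply: atypical_row_tail; rewrite ?addnS.
Qed.

Lemma borel_atypical m n (e : R) : borel_matrix_set (@atypical m n e).
Proof.
move=> d' T' X mX; have [L0|L0] := boolP (0 < edge_level n m e); last first.
  rewrite (_ : mkset _ = set0) ?predeqE => [|w]; first exact: measurable0.
  by split=> // -[]; rewrite (negbTE L0).
pose E i := [set w | atypical_row i (edge_level n m e)
     ((n - m).+1%:R - e ^+ 2 * n%:R) ((n - m).+1%:R + 2 * (e ^+ 2 * n%:R)) (X w)].
rewrite (_ : mkset _ =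
  [set w | small_form (edge_level n m e) (head_weight n e m n) (X w)] `|`
  \big[setU/set0]_(i < m) E i).
  apply: measurableU; first exact: borel_small_form.
  by apply: bigsetU_measurable => i _; exact: borel_atypical_row.
rewrite predeqE => w; split=> [[_ [sf|[i ai]]]|[sf|]].
- by left.
- by right; rewrite -bigcup_seq; exists i => //=; rewrite mem_index_enum.
- by split => //; left.
- by rewrite -bigcup_seq => -[i _ ai]; split => //; right; exists i.
Qed.

(** Union bound: [small_form_tail] costs two tails per row and the row distances one more, with at
    most [n] rows. *)
Lemma atypical_tail m n (e : R) (G : T -> 'M[R]_(m, n)) :
  0 < e <= 1 -> (m <= n)%N -> gauss_matrix P G ->
  (P [set w | atypical e (G w)] <= (3 * n%:R * chi_tail n e)%:E)%E.
Proof.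
move=> e01 mn gG; have mG := gauss_matrix_measurable gG.
have chi0 : 0 <= chi_tail n e by rewrite mulr_ge0// expR_ge0.
have mnR : (m%:R : R) <= n%:R by rewrite ler_nat.
have [L0|L0] := boolP (0 < edge_level n m e); last first.
  rewrite (_ : mkset _ = set0) ?measure0 ?lee_fin ?mulr_ge0// predeqE => w.
  by split=> // -[]; rewrite (negbTE L0).
pose F := [set w | small_form (edge_level n m e) (head_weight n e m n) (G w)].
pose E i := [set w | atypical_row i (edge_level n m e)
     ((n - m).+1%:R - e ^+ 2 * n%:R) ((n - m).+1%:R + 2 * (e ^+ 2 * n%:R)) (G w)].
have mF : measurable F by exact: borel_small_form.
have mE i : measurable (E i) by exact: borel_atypical_row.
have mU : measurable (\big[setU/set0]_(i < m) E i) by exact: bigsetU_measurable.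
apply: (@le_trans _ _ (P F + P (\big[setU/set0]_(i < m) E i))%E).
  apply: le_trans (measureU2 P mF mU); apply: le_measure; rewrite ?inE.
  - exact: borel_atypical.
  - exact: measurableU.
  - move=> w [_ [sf|[i ai]]]; first by left.
    by right; rewrite -bigcup_seq; exists i => //=; rewrite mem_index_enum.
have -> : 3 * n%:R * chi_tail n e = 2 * n%:R * chi_tail n e + n%:R * chi_tail n e.
  by ring.
rewrite EFinD; apply: leeD.
  have := small_form_tail e01 mn (leqnn m) (addnC n m) gG.
  move/le_trans; apply; rewrite lee_fin ler_wpM2r// ler_wpM2l//.
apply: (le_trans (measure_bigsetU_le _ mE)).
apply: (@le_trans _ _ (\sum_(i < m) (chi_tail n e)%:E)%E).
  by apply: lee_sum => i _; exact: atypical_row_tail_le.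
by rewrite sumEFin lee_fin sumr_const card_ord -[leLHS]mulr_natl ler_wpM2r.
Qed.

(** The exponential is split into two equal factors [z]; one absorbs [n] through [n z <= 2 / c], the
    other is the geometric term. *)
Lemma chi_tail_geometric n (e c : R) : 0 < c -> c = (e ^+ 2) ^+ 2 / 16 ->
  3 * n%:R * chi_tail n e <= 12 / c * expR (- (c / 2)) ^+ n.
Proof.
move=> c0 cE.
have -> : chi_tail n e = 2 * (expR (- (c / 2)) ^+ n * expR (- (c / 2)) ^+ n).
  rewrite -!expRM_natr -expRD /chi_tail; congr (_ * expR _).
  by rewrite cE; field.
set z := expR _ ^+ n; have z0 : 0 <= z by rewrite exprn_ge0// expR_ge0.
have nz : n%:R * z <= 2 / c.
  have zE : z = (expR (c / 2 * n%:R))^-1.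
    by rewrite /z -expRM_natr mulNr expRN.
  rewrite zE ler_pdivrMr ?expR_gt0//.
  have := expR_ge1Dx (c / 2 * n%:R); set E := expR _ => hE.
  have -> : n%:R = 2 / c * (c / 2 * n%:R) by field; rewrite gt_eqF.
  by rewrite ler_pM2l ?divr_gt0//; lra.
have := ler_wpM2r z0 nz; lra.
Qed.

(** Borel-Cantelli, with the probabilities dominated by a geometric series. *)
Lemma ae_eventually_typical (m : nat -> nat)
    (G : forall n, T -> 'M[R]_(m n, n)) (e : R) : 0 < e <= 1 ->
  (forall n, (m n <= n)%N) -> (forall n, gauss_matrix P (G n)) ->
  {ae P, forall w, \forall n \near \oo, ~ atypical e (G n w)}.
Proof.
move=> e01 mn gG; have /andP[e0 _] := e01.
pose F n := [set w | atypical e (G n w)].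
have mF n : measurable (F n).
  by apply: borel_atypical; exact: gauss_matrix_measurable (gG n).
have sumF : (\sum_(n <oo) P (F n) < +oo)%E.
  pose c := (e ^+ 2) ^+ 2 / 16; pose z := expR (- (c / 2)).
  have c0 : 0 < c by apply: divr_gt0 => //; do 2 apply: exprn_gt0.
  have z1 : z < 1 by rewrite -expR0 ltr_expR oppr_lt0 divr_gt0.
  have z0 : 0 <= z by exact: expR_ge0.
  apply: (@le_lt_trans _ _ (12 / c / (1 - z))%:E); last exact: ltry.
  apply: lime_le; first exact: is_cvg_nneseries.
  apply: nearW => k.
  apply: (@le_trans _ _ (\sum_(0 <= n < k) (geometric (12 / c) z n)%:E)%E).
    apply: lee_sum => n _; apply: (le_trans (atypical_tail e01 (mn n) (gG n))).
    by rewrite lee_fin; exact: (chi_tail_geometric n c0 erefl).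
  rewrite sumEFin lee_fin.
  have /(congr1 (fun f => f k)) := @geometric_seriesE R (12 / c) z (negbT (lt_eqF z1)).
  rewrite /series/= => ->; rewrite ler_pM2r ?invr_gt0 ?subr_gt0//.
  apply: ler_piMr; first by rewrite divr_ge0// ltW.
  by rewrite gerBl exprn_ge0.
have := lim_sup_set_cvg0 mF sumF => P0.
exists (lim_sup_set F); split => //.
  apply: bigcap_measurable => // n _; apply: bigcup_measurable => k _; exact: mF.
move=> w /= nw n _; apply: contrapT => nF; apply: nw; exists n => // k /= nk ak.
by apply: nF; exists k.
Qed.

End atypical_matrices.

Section gaussian_realization.
Context {R : realType} d (T : measurableType d) (P : probability T R).

Lemma gauss_matrix_realization m n (G : 'M[{RV P >-> R}]_(m, n)) :
  standard_gaussian G -> gauss_matrix P (realization G).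
Proof.
move=> [Gn Gi]; split=> [[i j]|B mB].
  under eq_fun do rewrite mxE; exact: measurable_funPT.
rewrite (_ : mkset _ = \bigcap_(ij in [set` [set: 'I_m * 'I_n]%SET])
    ((fun ij => G ij.1 ij.2) ij @^-1` B ij)); last first.
  rewrite predeqE => w; split=> [Bw ij _|Bw ij].
    by have := Bw ij; rewrite mxE.
  by rewrite mxE; apply: Bw; rewrite /= inE.
rewrite (Gi [set: 'I_m * 'I_n]%SET B (fun ij _ => mB ij)).
by apply: eq_big => [ij|ij _]; [rewrite inE|exact: (Gn ij.1 ij.2)].
Qed.

End gaussian_realization.

Lemma cvg_sqrt (R : realType) (f : nat -> R) (x : R) :
  f n @[n --> \oo] --> x -> Num.sqrt (f n) @[n --> \oo] --> Num.sqrt x.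
Proof. by move=> fx; exact: (cvg_comp f Num.sqrt fx (@sqrt_continuous R x)). Qed.

(** * Deterministic limits along a typical sequence *)

Section limits.
Context {R : realType} (gamma : R) (m : nat -> nat)
  (M : forall n, 'M[R]_(m n, n)).
Hypotheses (gamma01 : 0 < gamma < 1) (mn : forall n, (m n <= n)%N).
Hypothesis ratio : ((m n)%:R / n%:R : R) @[n --> \oo] --> gamma.
Hypothesis typical : forall j, \forall n \near \oo, ~ atypical (harmonic j) (M n).

Let r n : R := (m n)%:R / n%:R.

Let lam (e : R) n : R :=
  (Num.sqrt (1 + n%:R^-1) - Num.sqrt (r n)) ^+ 2 - n%:R^-1 - 8 * e.

(* Rescaled bounds for the squared distances of the rows; [lam] rescales
   [edge_level]. *)
Let lo (e : R) n : R := 1 - r n + n%:R^-1 - e ^+ 2.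
Let up (e : R) n : R := 1 - r n + n%:R^-1 + 2 * e ^+ 2.

Lemma cvg_invn : (n%:R^-1 : R) @[n --> \oo] --> 0.
Proof.
apply/gtr0_cvgV0; last exact: cvgr_idn.
by exists 1%N => // n /= n0; rewrite ltr0n.
Qed.

Let cvg_lo e : lo e n @[n --> \oo] --> 1 - gamma + 0 - e ^+ 2.
Proof.
apply: cvgB; last exact: cvg_cst; apply: cvgD; last exact: cvg_invn.
by apply: cvgB => //; exact: cvg_cst.
Qed.

Let cvg_up e : up e n @[n --> \oo] --> 1 - gamma + 0 + 2 * e ^+ 2.
Proof.
apply: cvgD; last exact: cvg_cst; apply: cvgD; last exact: cvg_invn.
by apply: cvgB => //; exact: cvg_cst.
Qed.

Let cvg_lam e : lam e n @[n --> \oo] --> (1 - Num.sqrt gamma) ^+ 2 - 0 - 8 * e.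
Proof.
apply: cvgB; last exact: cvg_cst; apply: cvgB; last exact: cvg_invn.
have c1 : (Num.sqrt (1 + n%:R^-1) - Num.sqrt (r n)) @[n --> \oo] --> 1 - Num.sqrt gamma.
  apply: cvgB; last exact: cvg_sqrt.
  rewrite -[X in _ --> X]sqrtr1 -[X in Num.sqrt X]addr0; apply: cvg_sqrt.
  by apply: cvgD; [exact: cvg_cst|exact: cvg_invn].
by apply: cvgM.
Qed.

Lemma typical_mpinv (e : R) n : (0 < n)%N -> 0 <= e -> ~ atypical e (M n) ->
  0 < lam e n -> 0 < lo e n ->
  [/\ r n / up e n <= sqn (mpinv (M n)), sqn (mpinv (M n)) <= r n / lo e n &
      Num.sqrt n%:R * spectral_norm (mpinv (M n)) <= (Num.sqrt (lam e n))^-1].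
Proof.
move=> n0 e0 typ lam0 lo0; have n0R : 0 < n%:R :> R by rewrite ltr0n.
have nN0 : n%:R != 0 :> R by rewrite gt_eqF.
have nmE : ((n - m n).+1%:R : R) = n%:R - (m n)%:R + 1 by rewrite -natr1 natrB.
have loE : (n - m n).+1%:R - e ^+ 2 * n%:R = n%:R * lo e n.
  by rewrite nmE /lo /r; field.
have upE : (n - m n).+1%:R + 2 * (e ^+ 2 * n%:R) = n%:R * up e n.
  by rewrite nmE /up /r; field.
have up0 : 0 < up e n.
  apply: (lt_le_trans lo0); rewrite /lo /up lerD2l.
  by have := sqr_ge0 e; lra.
have LE : edge_level n (m n) e = n%:R * lam e n.
  have nn : Num.sqrt n%:R ^+ 2 = n%:R :> R by rewrite sqr_sqrtr.
  have sq1 : Num.sqrt n.+1%:R = Num.sqrt n%:R * Num.sqrt (1 + n%:R^-1) :> R.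
    by rewrite -sqrtrM// mulrDr mulr1 divff// natr1.
  have sq2 : Num.sqrt (m n)%:R = Num.sqrt n%:R * Num.sqrt (r n) :> R.
    by rewrite -sqrtrM// /r mulrCA divff// mulr1.
  rewrite /edge_level sq1 sq2 -mulrBr exprMn nn /lam.
  by field.
have L0 : 0 < edge_level n (m n) e by rewrite LE mulr_gt0.
have typ1 : ~ small_form (edge_level n (m n) e) (head_weight n e (m n) n) (M n).
  by move=> sf; apply: typ; split => //; left.
have typ2 i : ~ atypical_row i (edge_level n (m n) e) (n%:R * lo e n) (n%:R * up e n) (M n).
  by rewrite -loE -upE => ai; apply: typ; split => //; right; exists i.
have [h1 h2 h3] := mpinv_bounds L0 (head_weight_ge0 n e0 (mn n))
  (mulr_gt0 n0R lo0) (mulr_gt0 n0R up0) typ1 typ2.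
split.
- by apply: le_trans h1; rewrite /r invfM mulrA.
- by apply: (le_trans h2); rewrite /r invfM mulrA.
- apply: (le_trans (ler_wpM2l (sqrtr_ge0 _) h3)).
  by rewrite LE sqrtrM// invfM mulrA divff ?mul1r// gt_eqF// sqrtr_gt0.
Qed.

Let cvg_harm : harmonic j @[j --> \oo] --> (0 : R).
Proof. exact: cvg_harmonic. Qed.

Let cvg_harm2 (a : R) : a * harmonic j ^+ 2 @[j --> \oo] --> (0 : R).
Proof.
rewrite -[X in _ --> X](mulr0 a); apply: cvgM; first exact: cvg_cst.
by rewrite -[X in _ --> X](mulr0 0); apply: cvgM.
Qed.

Let sqrt_gamma_lt1 : Num.sqrt gamma < 1.
Proof.
by have /andP[g0 g1] := gamma01; rewrite -sqrtr1 ltr_sqrt.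
Qed.

Let harm_ge0 j : 0 <= harmonic j :> R.
Proof. exact: harmonic_ge0. Qed.

Let bounds j n :=
  [/\ r n / up (harmonic j) n <= sqn (mpinv (M n)),
      sqn (mpinv (M n)) <= r n / lo (harmonic j) n &
      Num.sqrt n%:R * spectral_norm (mpinv (M n)) <=
        (Num.sqrt (lam (harmonic j) n))^-1].

Let near_bounds j :
  0 < (1 - Num.sqrt gamma) ^+ 2 - 0 - 8 * harmonic j ->
  0 < 1 - gamma + 0 - harmonic j ^+ 2 -> \forall n \near \oo, bounds j n.
Proof.
move=> j1 j2; near=> n; apply: typical_mpinv => //.
- by near: n; exists 1%N.
- by near: n; exact: typical.
- by near: n; exact: (cvgr_gt _ (@cvg_lam (harmonic j)) _ j1).
- by near: n; exact: (cvgr_gt _ (@cvg_lo (harmonic j)) _ j2).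
Unshelve. all: by end_near. Qed.

Lemma cvg_sqn_mpinv :
  sqn (mpinv (M n)) @[n --> \oo] --> gamma / (1 - gamma).
Proof.
have /andP[g0 g1] := gamma01; have g1' : 0 < 1 - gamma by rewrite subr_gt0.
apply/cvgrPdist_lt => eps eps0; set l := gamma / (1 - gamma).
have lamj : (1 - Num.sqrt gamma) ^+ 2 - 0 - 8 * harmonic j @[j --> \oo] -->
    (1 - Num.sqrt gamma) ^+ 2 - 0 - 8 * (0 : R).
  by apply: cvgB; [exact: cvg_cst|apply: cvgM; [exact: cvg_cst|exact: cvg_harm]].
have loj : 1 - gamma + 0 - harmonic j ^+ 2 @[j --> \oo] --> 1 - gamma.
  rewrite -[X in _ --> X]subr0 -[X in _ --> X - 0]addr0.
  apply: cvgB; first exact: cvg_cst.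
  by have := cvg_harm2 1; under eq_fun do rewrite mul1r.
have upj : 1 - gamma + 0 + 2 * harmonic j ^+ 2 @[j --> \oo] --> 1 - gamma.
  rewrite -[X in _ --> X]addr0 -[X in _ --> X + 0]addr0.
  by apply: cvgD; [exact: cvg_cst|exact: cvg_harm2].
have lam_gt0 : 0 < (1 - Num.sqrt gamma) ^+ 2 - 0 - 8 * 0.
  by rewrite mulr0 !subr0 exprn_gt0// subr_gt0.
have bj : gamma / (1 - gamma + 0 - harmonic j ^+ 2) @[j --> \oo] --> l.
  by apply: cvgM; [exact: cvg_cst|apply: cvgV => //; rewrite gt_eqF].
have aj : gamma / (1 - gamma + 0 + 2 * harmonic j ^+ 2) @[j --> \oo] --> l.
  by apply: cvgM; [exact: cvg_cst|apply: cvgV => //; rewrite gt_eqF].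
have lt1 : l < l + eps by rewrite ltrDl.
have lt2 : l - eps < l by rewrite ltrBlDr ltrDl.
(* The precision [j] is fixed first, so that the limiting bounds lie within [eps] of [l]; only then
   does [n] tend to infinity. *)
have [j [[j1 j2] [j3 [j4 j5]]]] : exists j,
    (0 < (1 - Num.sqrt gamma) ^+ 2 - 0 - 8 * harmonic j /\
     0 < 1 - gamma + 0 - harmonic j ^+ 2) /\
    (0 < 1 - gamma + 0 + 2 * harmonic j ^+ 2 /\
     (gamma / (1 - gamma + 0 - harmonic j ^+ 2) < l + eps /\
      l - eps < gamma / (1 - gamma + 0 + 2 * harmonic j ^+ 2))).
  apply: (@filter_ex _ \oo).
  near=> j; split; split; last split.
  - by near: j; exact: (cvgr_gt _ lamj _ lam_gt0).
  - by near: j; exact: (cvgr_gt _ loj _ g1').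
  - by near: j; exact: (cvgr_gt _ upj _ g1').
  - by near: j; exact: (cvgr_lt _ bj _ lt1).
  - by near: j; exact: (cvgr_gt _ aj _ lt2).
have bn : r n / lo (harmonic j) n @[n --> \oo] -->
    gamma / (1 - gamma + 0 - harmonic j ^+ 2).
  by apply: cvgM => //; apply: cvgV; [rewrite gt_eqF|exact: cvg_lo].
have an : r n / up (harmonic j) n @[n --> \oo] -->
    gamma / (1 - gamma + 0 + 2 * harmonic j ^+ 2).
  by apply: cvgM => //; apply: cvgV; [rewrite gt_eqF|exact: cvg_up].
near=> n.
have [h1 h2 _] : bounds j n by near: n; exact: near_bounds.
have k1 : r n / lo (harmonic j) n < l + eps by near: n; exact: (cvgr_lt _ bn _ j4).
have k2 : l - eps < r n / up (harmonic j) n by near: n; exact: (cvgr_gt _ an _ j5).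
by rewrite ltr_norml; apply/andP; split; lra.
Unshelve. all: by end_near. Qed.

Lemma limn_esup_le (u : nat -> \bar R) (c : \bar R) :
  (\forall n \near \oo, u n <= c)%E -> (limn_esup u <= c)%E.
Proof.
move=> uc; rewrite /limn_esup /limf_esup.
apply: (@le_trans _ _ (ereal_sup (u @` [set n | u n <= c]%E))).
  by apply: ereal_inf_lbound; exists [set n | u n <= c]%E.
by apply: ge_ereal_sup => _ [n /= un <-].
Qed.

Lemma limn_esup_spectral_norm_mpinv :
  (limn_esup (fun n => (Num.sqrt n%:R * spectral_norm (mpinv (M n)))%:E)
    <= (1 / (1 - Num.sqrt gamma))%:E)%E.
Proof.
have /andP[g0 g1] := gamma01; have g1' : 0 < 1 - gamma by rewrite subr_gt0.
have sg : 0 < 1 - Num.sqrt gamma by rewrite subr_gt0.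
(* A fixed precision [j] gives a limit slightly above the target; the slack [eps] makes room for
   it. *)
apply/lee_addgt0Pr => eps eps0; rewrite -EFinD; apply: limn_esup_le.
set l := 1 / _.
have lamj : (1 - Num.sqrt gamma) ^+ 2 - 0 - 8 * harmonic j @[j --> \oo] -->
    (1 - Num.sqrt gamma) ^+ 2.
  rewrite -[X in _ --> X]subr0 -[X in _ --> X - 0]subr0 -[X in _ --> _ - X](mulr0 8).
  by apply: cvgB; [exact: cvg_cst|apply: cvgM; [exact: cvg_cst|exact: cvg_harm]].
have loj : 1 - gamma + 0 - harmonic j ^+ 2 @[j --> \oo] --> 1 - gamma.
  rewrite -[X in _ --> X]subr0 -[X in _ --> X - 0]addr0.
  apply: cvgB; first exact: cvg_cst.
  by have := cvg_harm2 1; under eq_fun do rewrite mul1r.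
have lam_gt0 : 0 < (1 - Num.sqrt gamma) ^+ 2 by rewrite exprn_gt0.
have lt1 : (Num.sqrt ((1 - Num.sqrt gamma) ^+ 2))^-1 < l + eps.
  by rewrite sqrtr_sqr gtr0_norm// /l div1r ltrDl.
have sj : (Num.sqrt ((1 - Num.sqrt gamma) ^+ 2 - 0 - 8 * harmonic j))^-1 @[j --> \oo] -->
    (Num.sqrt ((1 - Num.sqrt gamma) ^+ 2))^-1.
  apply: cvgV; first by rewrite gt_eqF// sqrtr_gt0.
  exact: cvg_sqrt.
have [j [j1 [j2 j3]]] : exists j,
    0 < (1 - Num.sqrt gamma) ^+ 2 - 0 - 8 * harmonic j /\
    (0 < 1 - gamma + 0 - harmonic j ^+ 2 /\
     (Num.sqrt ((1 - Num.sqrt gamma) ^+ 2 - 0 - 8 * harmonic j))^-1 < l + eps).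
  apply: (@filter_ex _ \oo); near=> j; split; last split.
  - by near: j; exact: (cvgr_gt _ lamj _ lam_gt0).
  - by near: j; exact: (cvgr_gt _ loj _ g1').
  - by near: j; exact: (cvgr_lt _ sj _ lt1).
have sn : (Num.sqrt (lam (harmonic j) n))^-1 @[n --> \oo] -->
    (Num.sqrt ((1 - Num.sqrt gamma) ^+ 2 - 0 - 8 * harmonic j))^-1.
  apply: cvgV; first by rewrite gt_eqF// sqrtr_gt0.
  by apply: cvg_sqrt; exact: cvg_lam.
near=> n; rewrite lee_fin.
have [_ _ h] : bounds j n by near: n; exact: near_bounds.
apply: (le_trans h); apply: ltW; near: n; exact: (cvgr_lt _ sn _ j3).
Unshelve. all: by end_near. Qed.

End limits.

Theorem lemma6 (d : measure_display) (T : measurableType d) (R : realType)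
    (P : probability T R) (gamma : R) (m : nat -> nat)
    (G : forall n : nat, 'M[{RV P >-> R}]_(m n, n)) :
  0 < gamma < 1 ->
  (forall n : nat, (m n <= n)%N) ->
  ((m n)%:R / n%:R : R) @[n --> \oo] --> gamma ->
  (forall n : nat, standard_gaussian (G n)) ->
  {ae P, forall w : T,
    frobenius_norm (mpinv (realization (G n) w)) @[n --> \oo]
      --> Num.sqrt (gamma / (1 - gamma)) /\
    (limn_esup (fun n : nat =>
       (Num.sqrt n%:R * spectral_norm (mpinv (realization (G n) w)))%:E)
     <= (1 / (1 - Num.sqrt gamma))%:E)%E}.
Proof.
move=> gamma01 mn ratio gG.
have harm j : 0 < (harmonic j : R) <= 1.
  by rewrite harmonic_gt0/= /harmonic/= invf_le1 ?ler1n.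
(* The precisions run over the countable family [harmonic j], so the exceptional sets have a null
   union. *)
have := ae_foralln (fun j => ae_eventually_typical (harm j) mn
  (fun n => gauss_matrix_realization (gG n))).
apply: filterS => w typ; split.
  by apply: cvg_sqrt; exact: cvg_sqn_mpinv.
exact: limn_esup_spectral_norm_mpinv.
Qed.
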